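(* Let the finitely generated group $G$ act acylindrically by isometries on the geodesic Gromov-hyperbolic space $X$. Let $\mu_0$ be a probability measure on $G$ with exponential tail whose support generates a non-elementary semigroup. Then $\mu_0$ has a neighborhood $\mathcal{N}$ for which there exists a constant $C>0$ such that for every $\mu\in\mathcal{N}$, every positive integer $n$ and every $g_0\in G$, $$\mathbb{P}^\mu\big[d_X(id,g_0Z_n)-d_X(id,g_0)\le n/C\big]\le Ce^{-n/C}.$$ In particular, for $\mu\in\mathcal{N}$ the rate of escape $\lim_n\frac1n\mathbb{E}^\mu[d_X(id,Z_n)]$ is strictly positive.
   Context: Acylindrical action: for every $r\ge0$ there exist $R,N\ge0$ such that whenever $x,y\in X$ satisfy $d_X(x,y)\ge R$, at most $N$ elements $g\in G$ satisfy $d_X(x,gx)\le r$ and $d_X(y,gy)\le r$. A basepoint $x_0\in X$ is fixed and $d_X(g,h):=d_X(gx_0,hx_0)$ for $g,h\in G$. A sub-semigroup of $G$ is non-elementary if it contains two elements acting loxodromically on $X$ that freely generate a free group. The semigroup generated by the support of $\mu_0$ is the smallest sub-semigroup of $G$ containing it. Exponential tail: there is $\alpha>0$ with $\sum_{x\in G}e^{\alpha d_G(id,x)}\mu_0(x)<\infty$, $d_G$ a word metric on $G$. For probability measures on $G$ with the same support, $\mathbf{n}(\mu,\mu_0)=\sup_a\max\big(\frac{\mu(a)}{\mu_0(a)},\frac{\mu_0(a)}{\mu(a)}\big)-1$ (sup over the support); $\mathbf{n}=\infty$ if the supports differ. A neighborhood of $\mu_0$ is a set $\{\mu:\mathbf{n}(\mu,\mu_0)\le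 K\}$ with $K>0$. Under $\mathbb{P}^\mu$ (expectation $\mathbb{E}^\mu$), $X_1,X_2,\dots$ are i.i.d. of law $\mu$, $Z_0=id$, $Z_n=X_1\cdots X_n$. *)

(* Defs.v *)
From HB Require Import structures.
From mathcomp Require Import all_boot all_order all_algebra.
From mathcomp Require Import all_classical all_reals all_analysis.

Set Implicit Arguments.
Unset Strict Implicit.
Unset Printing Implicit Defensive.

Import Order.TTheory GRing.Theory Num.Theory.
Import numFieldNormedType.Exports.

Local Open Scope classical_set_scope.
Local Open Scope ring_scope.

Definition geodesic (R : realType) (X : metricType R) : Prop :=
  forall x y : X, exists gamma : R -> X,
    [/\ gamma 0 = x,
        gamma (mdist x y) = y &
        forall s t : R, 0 <= s <= mdist x y -> 0 <= t <= mdist x y ->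
          mdist (gamma s) (gamma t) = `|s - t| ].

Definition gromov_product (R : realType) (X : metricType R) (w x y : X) : R :=
  (mdist x w + mdist y w - mdist x y) / 2.

Definition gromov_hyperbolic (R : realType) (X : metricType R) : Prop :=
  exists2 delta : R, 0 <= delta &
    forall w x y z : X,
      Num.min (gromov_product w x y) (gromov_product w y z) - delta
        <= gromov_product w x z.

Record isometric_action (R : realType) (G : groupType) (X : metricType R)
    (act : G -> X -> X) : Prop := IsometricAction {
  act_one : forall x, act 1%g x = x;
  act_mul : forall g h x, act (g * h)%g x = act g (act h x);
  act_isometry : forall g x y, mdist (act g x) (act g y) = mdist x y
}.

Definition acylindrical (R : realType) (G : groupType) (X : metricType R)
    (act : G -> X -> X) : Prop :=
  forall r : R, 0 <= r ->
    exists (D : R) (N : nat), 0 <= D /\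
      forall x y : X, D <= mdist x y ->
        ([set g : G | mdist x (act g x) <= r /\ mdist y (act g y) <= r]
           #<= `I_N)%card.

Definition orbit_dist (R : realType) (G : groupType) (X : metricType R)
    (act : G -> X -> X) (x0 : X) (g h : G) : R :=
  mdist (act g x0) (act h x0).

Definition expgz (G : groupType) (g : G) (m : int) : G :=
  match m with
  | Posz n => (g ^+ n)%g
  | Negz n => (g ^- n.+1)%g
  end.

(* Every orbit map m |-> g^m x is a quasi-isometric embedding of Z in X. *)
Definition loxodromic (R : realType) (G : groupType) (X : metricType R)
    (act : G -> X -> X) (g : G) : Prop :=
  forall x : X, exists lambda c : R, [/\ 1 <= lambda, 0 <= c &
    forall m n : int,
      lambda^-1 * `|m - n|%:~R - c
        <= mdist (act (expgz g m) x) (act (expgz g n) x)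
        <= lambda * `|m - n|%:~R + c].

(* Words in a, b and their inverses: the first component of a letter selects
   the generator, the second one says whether it is inverted. *)
Definition letter (G : groupType) (a b : G) (l : bool * bool) : G :=
  let g := if l.1 then a else b in if l.2 then (g^-1)%g else g.

Definition reduced_word (w : seq (bool * bool)) : bool :=
  sorted (fun l l' => ~~ ((l.1 == l'.1) && (l.2 != l'.2))) w.

Definition freely_generate (G : groupType) (a b : G) : Prop :=
  forall w : seq (bool * bool), w <> [::] -> reduced_word w ->
    (\prod_(l <- w) letter a b l)%g <> 1%g.

Definition subsemigroup (G : groupType) (S : set G) : Prop :=
  forall g h : G, S g -> S h -> S (g * h)%g.

Definition generated_semigroup (G : groupType) (A : set G) : set G :=
  smallest (@subsemigroup G) A.

Definition non_elementary (R : realType) (G : groupType) (X : metricType R)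
    (act : G -> X -> X) (S : set G) : Prop :=
  exists a b : G, [/\ S a, S b, loxodromic act a, loxodromic act b &
                      freely_generate a b].

Definition word_in (G : groupType) (S : seq G) (s : seq G) : bool :=
  all (fun x => (x \in S) || ((x^-1)%g \in S)) s.

Definition generates (G : groupType) (S : seq G) : Prop :=
  forall g : G, exists2 s : seq G, word_in S s & g = (\prod_(x <- s) x)%g.

Definition word_metric (R : realType) (G : groupType) (S : seq G)
    (g h : G) : R :=
  inf [set (size s)%:R | s in [set s : seq G |
         word_in S s /\ (\prod_(x <- s) x = g^-1 * h)%g ]].

(* Probability measures on the countable group G are given by their mass
   functions. *)

Definition is_probability (R : realType) (G : groupType) (mu : G -> R) : Prop :=
  (forall g, 0 <= mu g) /\ \esum_(g in [set: G]) (mu g)%:E = 1%E.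

Definition msupport (R : realType) (G : groupType) (mu : G -> R) : set G :=
  [set g | 0 < mu g].

Definition exponential_tail (R : realType) (G : groupType) (S : seq G)
    (mu : G -> R) : Prop :=
  exists2 alpha : R, 0 < alpha &
    (\esum_(g in [set: G])
        (expR (alpha * word_metric R S 1%g g) * mu g)%:E < +oo)%E.

Definition ndist (R : realType) (G : groupType) (mu mu0 : G -> R) : \bar R :=
  if `[< msupport mu = msupport mu0 >] then
    (ereal_sup [set (Num.max (mu a / mu0 a) (mu0 a / mu a))%:E
                  | a in msupport mu0] - 1)%E
  else +oo%E.

Definition is_neighborhood (R : realType) (G : groupType) (mu0 : G -> R)
    (N : set (G -> R)) : Prop :=
  exists2 K : R, 0 < K &
    N = [set mu | is_probability mu /\ (ndist mu mu0 <= K%:E)%E].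

(* The increments are indexed from 0, X i being the (i+1)-st one, and G carries
   the discrete sigma-algebra. *)

Record iid (R : realType) (G : groupType) (d : measure_display)
    (Omega : measurableType d) (P : probability Omega R) (mu : G -> R)
    (X : nat -> Omega -> G) : Prop := IID {
  iid_measurable : forall i (A : set G), measurable (X i @^-1` A);
  iid_law : forall i g, P (X i @^-1` [set g]) = (mu g)%:E;
  iid_indep : forall (s : seq nat) (A : nat -> set G), uniq s ->
    P (\bigcap_(i in [set` s]) (X i @^-1` A i))
      = (\prod_(i <- s) P (X i @^-1` A i))%E
}.

Definition walk (G : groupType) (Omega : Type) (X : nat -> Omega -> G)
    (n : nat) (w : Omega) : G :=
  (\prod_(i < n) X i w)%g.

(* Main.v *)
(** Let o be the base point. For a finite list l of points of X put
    F(l) = sum over x, y in l of exp(- al d(x, y)). By hyperbolicity the associated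
    bilinear form satisfies the Cauchy-Schwarz inequality up to a multiplicative
    constant, and a ping-pong argument then shows that replacing l by the union of
    its images under a large Schottky family s_1, ..., s_q multiplies F by a factor
    much smaller than q^2. Acylindricity provides such a family b^i a^n b^(q-i) of
    words of the same length in the support of mu_0. As F is invariant under
    isometries, this contraction survives arbitrary other increments, so that
    E exp(- al d(Z_n o, v)) decays exponentially in n, uniformly in v in X.

    Let v be the point at distance r = eps n from o on a geodesic from o to y. If
    d(Z_n o, y) - d(o, y) is small, then Z_n o is near v or the path
    (Z_i o) passes at a distance O(log n) from v, up to the size of a jump; both are
    exponentially unlikely. With the exponential moment, this gives an n and a
    lam > 0 with E exp(- lam (d(Z_n o, y) - d(o, y))) <= 1/2 for all y, a condition
    that is stable under small perturbations of mu_0 and can be iterated. *)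

Require Import Defs.
From HB Require Import structures.
From mathcomp Require Import all_boot all_order all_algebra.
From mathcomp Require Import all_classical all_reals all_analysis.
From mathcomp Require Import ring lra zify.

Set Implicit Arguments.
Unset Strict Implicit.
Unset Printing Implicit Defensive.

Import Order.TTheory GRing.Theory Num.Theory.
Import numFieldNormedType.Exports.

Local Open Scope classical_set_scope.
Local Open Scope ring_scope.

(** * Almost Cauchy-Schwarz inequality for exponential kernels *)

(** In a tree, the relations [(x|y) >= j] are transitive, so [exp(- al d(x, y)) = m(x) m(y) exp(2 al
    (x|y))], with [m = exp(- al d(., o))], is a positive combination of squares and F is a positive
    form. In a hyperbolic space transitivity fails by [delta], which costs a constant depending on
    [al] and [delta] only. It is fixed before the Schottky family is chosen, so a large q beats it;
    [al] itself is imposed by the exponential moment.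

    The contraction is used by duality: a function u on X is controlled when its sum over every list
    l is at most c F(l)^(1/2). Composing u with an isometry and averaging keep c, so the increments
    outside the Schottky family cost nothing, whatever the position of the walk.

    Uniformity in y is forced by [g_0], because d(o, g_0 Z_n o) = d(Z_n o, g_0^-1 o); it is also
    what makes the exponential cocycle submultiplicative in time. A bound 1 + K on densities costs
    (1 + K)^n over n increments, hence the need to reduce everything to an inequality at one fixed
    time before perturbing the measure. *)

Lemma ler_sum_mem (R : realType) (T : eqType) (F : T -> R) (s : seq T) (y : T) :
  (forall z, 0 <= F z) -> y \in s -> F y <= \sum_(z <- s) F z.
Proof. by move=> F0 ys; rewrite (big_rem y)//= lerDl sumr_ge0. Qed.

Lemma sum_indicator_le1 (R : realType) (I : finType) (P : pred I) :
  (forall i j, P i -> P j -> i = j) -> \sum_i (P i)%:R <= 1 :> R.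
Proof.
move=> Pinj; have [i Pi|P0] := pickP P; last first.
  by rewrite big1// => i _; rewrite P0.
rewrite (bigD1 i)//= big1 ?addr0 ?Pi// => j ji.
by case Pj: (P j) => //; rewrite (Pinj _ _ Pi Pj) eqxx in ji.
Qed.

Section relation_kernel.
Context {R : realType} {T : eqType}.
Variables (r r2 : rel T) (m : T -> R).
Hypothesis m0 : forall x, 0 < m x.
Hypothesis r_r2l : forall x y z, r x y -> r x z -> r2 y z.
Hypothesis r_r2r : forall x y z, r x z -> r y z -> r2 x y.

Definition relsum (e : rel T) (l l' : seq T) : R :=
  \sum_(x <- l) \sum_(y <- l') m x * m y * (e x y)%:R.

(* AM-GM along the edges [x ~ y] with the weight [h x / f x], where [f x] is the
   mass of the neighbours of [x] in [l'] and [h x] the mass of the [r2]-neighbours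
   of [x] in [l]; the weight cancels because [r] composed with itself is
   contained in [r2]. *)
Lemma relsum_le (c : R) (l l' : seq T) : 0 < c ->
  2 * relsum r l l' <= c * relsum r2 l l + c^-1 * relsum r2 l' l'.
Proof.
move=> c0.
pose f x := \sum_(y <- l') m y * (r x y)%:R.
pose M y := \sum_(x <- l) m x * (r x y)%:R.
pose h x := \sum_(x' <- l) m x' * (r2 x x')%:R.
pose g y := \sum_(y' <- l') m y' * (r2 y y')%:R.
have mr0 (e : rel T) x y : 0 <= m y * (e x y)%:R by rewrite mulr_ge0// ltW.
have mr0' (e : rel T) x y : 0 <= m y * (e y x)%:R by rewrite mulr_ge0// ltW.
have f0 x y : y \in l' -> r x y -> 0 < f x.
  move=> yl rxy; apply: lt_le_trans (ler_sum_mem (mr0 r x) yl).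
  by rewrite rxy mulr1.
have M0 x y : x \in l -> r x y -> 0 < M y.
  move=> xl rxy; apply: lt_le_trans (ler_sum_mem (mr0' r y) xl).
  by rewrite rxy mulr1.
have Mh x y : r x y -> M y <= h x.
  move=> rxy; apply: ler_sum => x' _; rewrite ler_wpM2l ?(ltW (m0 _))//.
  by case rx'y: (r x' y) => //; rewrite (r_r2r rxy rx'y).
have fg x y : r x y -> f x <= g y.
  move=> rxy; apply: ler_sum => y' _; rewrite ler_wpM2l ?(ltW (m0 _))//.
  by case rxy': (r x y') => //; rewrite (r_r2l rxy rxy').
have h0 x y : x \in l -> r x y -> 0 < h x.
  by move=> xl rxy; apply: lt_le_trans (Mh _ _ rxy); exact: M0 rxy.
have key x y : x \in l -> y \in l' -> 2 * (m x * m y * (r x y)%:R) <=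
   c * (m x * h x * (f x)^-1 * (m y * (r x y)%:R)) +
   c^-1 * (m y * g y * (M y)^-1 * (m x * (r x y)%:R)).
  move=> xl yl; case rxy: (r x y); last by rewrite !mulr0 addr0.
  rewrite !mulr1.
  have f1 := f0 _ _ yl rxy; have h1 := h0 _ _ xl rxy; have M1 := M0 _ _ xl rxy.
  have amgm : 2 <= c * (h x / f x) + c^-1 * (f x / h x).
    have t0 : 0 < c * (h x / f x) by rewrite mulr_gt0// divr_gt0.
    have -> : c^-1 * (f x / h x) = (c * (h x / f x))^-1 by rewrite !invfM invrK [f x / _]mulrC.
    set t := c * _ in t0 *.
    rewrite -(ler_pM2r t0) [leRHS]mulrDl mulVf ?gt_eqF//.
    have := sqr_ge0 (t - 1); rewrite expr2; lra.
  have fh : f x / h x <= g y / M y.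
    apply: ler_pM => //; first exact: ltW.
    - by rewrite invr_ge0 ltW.
    - exact: fg.
    - by rewrite lef_pV2 ?posrE//; exact: Mh.
  have mm : 0 < m x * m y by rewrite mulr_gt0.
  have -> : c * (m x * h x * (f x)^-1 * m y) + c^-1 * (m y * g y * (M y)^-1 * m x)
     = (m x * m y) * (c * (h x / f x) + c^-1 * (g y / M y)) by ring.
  rewrite mulrC ler_wpM2l//; first exact: ltW.
  apply: le_trans amgm _; rewrite lerD2l ler_wpM2l// invr_ge0; exact: ltW.
rewrite /relsum mulr_sumr.
under eq_bigr do rewrite mulr_sumr.
apply: (@le_trans _ _ (\sum_(x <- l) \sum_(y <- l')
   (c * (m x * h x * (f x)^-1 * (m y * (r x y)%:R)) +
   c^-1 * (m y * g y * (M y)^-1 * (m x * (r x y)%:R))))).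
  rewrite big_seq [leRHS]big_seq; apply: ler_sum => x xl.
  by rewrite big_seq [leRHS]big_seq; apply: ler_sum => y yl; exact: key.
under eq_bigr do rewrite big_split/=.
rewrite big_split/= lerD//.
  rewrite mulr_sumr; apply: ler_sum => x _.
  rewrite -!mulr_sumr ler_wpM2l//; first exact: ltW.
  under [leRHS]eq_bigr do rewrite -mulrA.
  rewrite -mulr_sumr -/(f x) -/(h x) -!mulrA ler_wpM2l//; first exact: ltW.
  rewrite ler_piMr//; first by rewrite sumr_ge0.
  by have [->|fx] := eqVneq (f x) 0; rewrite ?mulr0// mulVf.
rewrite exchange_big/= mulr_sumr; apply: ler_sum => y _.
rewrite -!mulr_sumr ler_wpM2l//; first by rewrite invr_ge0 ltW.
under [leRHS]eq_bigr do rewrite -mulrA.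
rewrite -mulr_sumr -/(M y) -/(g y) -!mulrA ler_wpM2l//; first exact: ltW.
rewrite ler_piMr//; first by rewrite sumr_ge0.
by have [->|My] := eqVneq (M y) 0; rewrite ?mulr0// mulVf.
Qed.

End relation_kernel.

Section layers.
Context {R : realType}.
Variable (a : R).
Hypothesis a0 : 0 < a.

(** Increments of [j -> exp(a j)], the one at [0] being the full value [1]. For [0 <= g < M] the
    layers up to [g] telescope to the exponential of [a] times the integer part of [g]: a discrete
    layer-cake formula, exact up to a factor [exp a]. *)
Definition layer (j : nat) : R :=
  expR (a * j%:R) - (if j is j'.+1 then expR (a * j'%:R) else 0).

Lemma layer_ge0 j : 0 <= layer j.
Proof.
case: j => [|j]; rewrite /layer ?subr0 ?expR_ge0//.
by rewrite subr_ge0 ler_expR ler_pM2l// ler_nat.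
Qed.

Let S (M : nat) (g : R) := \sum_(j < M) layer j * (j%:R <= g)%R%:R.

Let S_full M g : M%:R <= g -> S M.+1 g = expR (a * M%:R).
Proof.
rewrite /S; elim: M => [|M IH] Mg.
  by rewrite big_ord1 /= Mg /layer subr0 mulr1.
rewrite big_ord_recr /= IH; last by rewrite (le_trans _ Mg)// ler_nat.
by rewrite Mg mulr1 /layer addrC subrK.
Qed.

Let S_skip M g : g < M%:R -> S M.+1 g = S M g.
Proof. by move=> gM; rewrite /S big_ord_recr /= leNgt gM mulr0 addr0. Qed.

Lemma layers_le M g : \sum_(j < M) layer j * (j%:R <= g)%R%:R <= expR (a * g).
Proof.
rewrite -/(S M g); elim: M => [|M IH]; first by rewrite /S big_ord0 expR_ge0.
have [Mg|gM] := leP M%:R g; last by rewrite S_skip.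
by rewrite S_full// ler_expR ler_pM2l.
Qed.

Lemma layers_ge M g : 0 <= g -> g < M%:R ->
  expR (a * (g - 1)) <= \sum_(j < M) layer j * (j%:R <= g)%R%:R.
Proof.
rewrite -/(S M g) => g0; elim: M => [|M IH gM1]; first by rewrite ltNge g0.
have [Mg|gM] := leP M%:R g; last by rewrite S_skip// IH.
rewrite S_full// ler_expR ler_pM2l// lerBlDr.
by rewrite ltW// (lt_le_trans gM1)// -natr1.
Qed.

End layers.

Section gromov_product_theory.
Context {R : realType} {X : metricType R}.
Implicit Types o x y z : X.

Lemma gromov_productC o x y : gromov_product o x y = gromov_product o y x.
Proof. by rewrite /gromov_product (metric_sym x y) (addrC (mdist x o)). Qed.

Lemma gromov_product_ge0 o x y : 0 <= gromov_product o x y.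
Proof.
rewrite /gromov_product divr_ge0// subr_ge0.
by rewrite (le_trans (metric_triangle _ o _))// (metric_sym o y).
Qed.

Lemma mdist_gromov_product o x y :
  mdist x y = mdist x o + mdist y o - 2 * gromov_product o x y.
Proof. by rewrite /gromov_product; field. Qed.

Lemma gromov_product_le_mdist o x y : gromov_product o x y <= mdist x o.
Proof.
have := metric_triangle y x o; rewrite /gromov_product (metric_sym y x); lra.
Qed.

Lemma gromov_product_ge_subr o x y :
  mdist o x - mdist x y <= gromov_product o x y.
Proof.
have := metric_triangle x y o; rewrite /gromov_product (metric_sym o x); lra.
Qed.

Lemma gromov_product_basepoint o o' x y :
  gromov_product o x y <= gromov_product o' x y + mdist o o'.
Proof.
have := metric_triangle x o' o; have := metric_triangle y o' o.
rewrite /gromov_product (metric_sym o' o); lra.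
Qed.

Definition hyperbolic_at (delta : R) (o : X) := forall x y z,
  Num.min (gromov_product o x y) (gromov_product o y z) - delta
    <= gromov_product o x z.

Lemma hyperbolic_atP delta o x y z t : hyperbolic_at delta o ->
  t <= gromov_product o x y -> t <= gromov_product o y z ->
  t - delta <= gromov_product o x z.
Proof.
move=> hyp txy tyz; apply: le_trans (hyp x y z).
by rewrite lerB// le_min txy tyz.
Qed.

End gromov_product_theory.

Section kernel.
Context {R : realType} {X : metricType R}.
Variable al : R.
Hypothesis al0 : 0 < al.
Implicit Types (o x y z : X) (l : seq X).

Definition kern l l' : R :=
  \sum_(x <- l) \sum_(y <- l') expR (- (al * mdist x y)).

Lemma kern_ge0 l l' : 0 <= kern l l'.
Proof. by rewrite /kern sumr_ge0// => x _; rewrite sumr_ge0. Qed.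

Lemma kern_map_isometry (f : X -> X) l :
  (forall x y, mdist (f x) (f y) = mdist x y) -> kern (map f l) (map f l) = kern l l.
Proof.
move=> fi; rewrite /kern big_map; apply: eq_bigr => x _.
by rewrite big_map; under eq_bigr do rewrite fi.
Qed.

(** Triangle inequality through [z]. It places the test function [exp(- al d(., z))] below the
    square root of the kernel form, the starting point of the later iteration. *)
Lemma sqr_sum_expR_le_kern l z :
  (\sum_(x <- l) expR (- (al * mdist x z))) ^+ 2 <= kern l l.
Proof.
rewrite expr2 mulr_suml /kern; apply: ler_sum => x _.
rewrite mulr_sumr; apply: ler_sum => y _.
rewrite -expRD ler_expR -opprD lerN2 -mulrDr ler_pM2l//.
by rewrite (le_trans (metric_triangle _ z _))// (metric_sym z y).
Qed.

Lemma sum_expR_mul_le_kern l z w :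
  (\sum_(x <- l) expR (- (al * mdist x z))) * (\sum_(x <- l) expR (- (al * mdist x w)))
    <= kern l l.
Proof.
have := sqr_sum_expR_le_kern l z; have := sqr_sum_expR_le_kern l w.
set a := \sum_(_ <- _) _; set b := \sum_(_ <- _) _.
have := sqr_ge0 (a - b); rewrite !expr2; nra.
Qed.

(** The factor [exp(2 al)] pays for rounding Gromov products to integers, and [exp(2 al delta)] for
    the [delta] lost when two threshold relations are composed. *)
Definition kern_const (delta : R) := expR (2 * al * (1 + delta)).

(* A Cauchy-Schwarz inequality up to a multiplicative constant: [exp (2 al (x|y))]
   is split into layers [(x|y) >= j], to each of which [relsum_le] applies. *)
Lemma kern_amgm (delta : R) (o : X) (c : R) l l' : hyperbolic_at delta o -> 0 < c ->
  2 * kern l l' <= kern_const delta * (c * kern l l + c^-1 * kern l' l').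
Proof.
move=> hyp c0.
pose gp := gromov_product o.
have [m mE] : exists m : X -> R, forall x, m x = expR (- (al * mdist x o)).
  by eexists.
have kE x y : expR (- (al * mdist x y)) = m x * m y * expR (2 * al * gp x y).
  by rewrite !mE -!expRD; congr expR; rewrite (mdist_gromov_product o x y) -/(gp x y); ring.
(* Enough layers for every pair of the two lists. *)
pose M := (Num.truncn (\sum_(x <- l) \sum_(y <- l') gp x y)).+1.
have gM x y : x \in l -> y \in l' -> gp x y < M%:R.
  move=> xl yl; have gp0 x' y' : 0 <= gp x' y' by exact: gromov_product_ge0.
  apply: le_lt_trans (truncnS_gt _).
  apply: le_trans (ler_sum_mem (fun y => gp0 x y) yl) _.
  by apply: (ler_sum_mem (F := fun x => \sum_(y <- l') gp x y)) => // z; rewrite sumr_ge0.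
(* Hyperbolicity at [o] says that [e1 j] composed with itself lies in [e2 j]. *)
pose e1 (j : nat) : rel X := fun x y => j%:R <= gp x y.
pose e2 (j : nat) : rel X := fun x y => j%:R - delta <= gp x y.
have ub l1 l2 : \sum_(j < M) layer (2 * al) j * relsum m (e2 j) l1 l2 <=
    expR (2 * al * delta) * kern l1 l2.
  rewrite /relsum; under eq_bigr do rewrite mulr_sumr.
  rewrite exchange_big/= /kern mulr_sumr; apply: ler_sum => x _.
  under eq_bigr do rewrite mulr_sumr.
  rewrite exchange_big/= mulr_sumr; apply: ler_sum => y _.
  rewrite kE mulrCA -expRD -mulrDr.
  under eq_bigr do rewrite mulrCA.
  rewrite -mulr_sumr ler_wpM2l ?mulr_ge0 ?mE ?expR_ge0//.
  rewrite [delta + _]addrC; apply: le_trans (layers_le _ M _); last by rewrite mulr_gt0.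
  by apply: ler_sum => j _; rewrite /e2 lerBlDr.
have lb : kern l l' <= expR (2 * al) * \sum_(j < M) layer (2 * al) j * relsum m (e1 j) l l'.
  rewrite /relsum; under eq_bigr do rewrite mulr_sumr.
  rewrite exchange_big/= /kern mulr_sumr.
  rewrite big_seq [leRHS]big_seq; apply: ler_sum => x xl.
  under eq_bigr do rewrite mulr_sumr.
  rewrite exchange_big/= mulr_sumr.
  rewrite big_seq [leRHS]big_seq; apply: ler_sum => y yl.
  rewrite kE; under eq_bigr do rewrite mulrCA.
  rewrite -mulr_sumr [leRHS]mulrCA ler_wpM2l ?mulr_ge0 ?mE ?expR_ge0//.
  have := @layers_ge R (2 * al) _ M (gp x y) (gromov_product_ge0 _ _ _) (gM _ _ xl yl).
  rewrite mulr_gt0// => /(_ isT) /(ler_wpM2l (expR_ge0 (2 * al))).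
  by rewrite -expRD mulrBr mulr1 addrC subrK.
have mid : 2 * \sum_(j < M) layer (2 * al) j * relsum m (e1 j) l l' <=
   c * \sum_(j < M) layer (2 * al) j * relsum m (e2 j) l l +
   c^-1 * \sum_(j < M) layer (2 * al) j * relsum m (e2 j) l' l'.
  rewrite !mulr_sumr -big_split/=; apply: ler_sum => j _.
  rewrite mulrCA [c * _]mulrCA [c^-1 * _]mulrCA -mulrDr ler_wpM2l//.
    by apply: layer_ge0; rewrite mulr_gt0.
  apply: relsum_le => //.
  - by move=> x; rewrite mE expR_gt0.
  - move=> x y z jxy jxz; apply: (hyperbolic_atP (y := x)) => //.
    by rewrite gromov_productC.
  - move=> x y z jxy jxz; apply: (hyperbolic_atP (y := z)) => //.
    by rewrite gromov_productC.
have -> : kern_const delta = expR (2 * al) * expR (2 * al * delta).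
  by rewrite -expRD /kern_const mulrDr mulr1.
rewrite -mulrA; apply: le_trans (ler_wpM2l _ lb) _ => //.
rewrite mulrCA ler_wpM2l ?expR_ge0//; apply: le_trans mid _.
rewrite mulrDr mulrCA [_ * (c^-1 * _)]mulrCA.
by rewrite lerD// ler_wpM2l// ?invr_ge0 ltW.
Qed.

End kernel.

(** * Contraction under a Schottky family *)

Section contraction.
Context {R : realType} {X : metricType R}.
Variables (al delta tau k : R) (o : X) (q : nat).
Variables (sig : 'I_q -> X -> X) (pre : 'I_q -> X).
Hypothesis al0 : 0 < al.
Hypothesis delta0 : 0 <= delta.
Hypothesis hyp : hyperbolic_at delta o.
Hypothesis sig_isometry : forall i x y, mdist (sig i x) (sig i y) = mdist x y.
Hypothesis sig_pre : forall i, sig i (pre i) = o.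
Hypothesis sig_far : forall i j, i != j -> gromov_product o (sig i o) (sig j o) <= tau.
Hypothesis pre_far : forall i j, i != j -> gromov_product o (pre i) (pre j) <= tau.
Hypothesis k_le : forall i, k <= mdist (sig i o) o.

(** Depth of the shadows below. A common point of two of them would give their centres a Gromov
    product at least [t - delta = tau + 1]; the margin [1] contradicts [sig_far] and [pre_far]. *)
Let t := tau + delta + 1.
Hypothesis t_le : 2 * t + delta <= k.

Let gp := gromov_product o.
Let e (x y : X) := expR (- (al * mdist x y)).
(** Gain for pairs in general position: [notU] gains [k] and loses [2 t], and [sep] loses a further
    [2 t + 2 delta]. *)
Let ep := expR (- (al * (k - (4 * t + 2 * delta)))).
(** [U i] is the repelling shadow of [sig i], around the preimage of [o], and [V j] the attracting
    shadow of [sig j], around the image of [o]. *)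
Let U (i : 'I_q) (x : X) := t <= gp x (pre i).
Let V (j : 'I_q) (z : X) := t <= gp z (sig j o).

Let U_inj i j x : U i x -> U j x -> i = j.
Proof.
move=> Ui Uj; apply/eqP; apply/negPn/negP => /pre_far.
have : t - delta <= gp (pre i) (pre j).
  by apply: (hyperbolic_atP (y := x) hyp) => //; rewrite gromov_productC.
rewrite /gp /t; lra.
Qed.

Let V_inj i j x : V i x -> V j x -> i = j.
Proof.
move=> Ui Uj; apply/eqP; apply/negPn/negP => /sig_far.
have : t - delta <= gp (sig i o) (sig j o).
  by apply: (hyperbolic_atP (y := x) hyp) => //; rewrite gromov_productC.
rewrite /gp /t; lra.
Qed.

Let sig_mdist i x : mdist (sig i x) o = mdist x (pre i).
Proof. by rewrite -(sig_pre i) sig_isometry. Qed.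

(** Ping-pong: moving the base point by [sig i], the product of [sig i x] and [sig i o] at [o]
    equals d(pre i, o) - (x|pre i), hence is at least [k - t]. So a point outside the repelling
    shadow lands deep in the attracting one. *)
Let notU i x : ~~ U i x ->
  mdist x o + k - 2 * t <= mdist (sig i x) o /\ t + delta <= gp (sig i x) (sig i o).
Proof.
rewrite /U -ltNge => Ux.
have := mdist_gromov_product o x (pre i); rewrite -/(gp _ _) -sig_mdist => dx.
have pi : mdist (pre i) o = mdist (sig i o) o.
  by rewrite sig_mdist metric_sym.
have := k_le i; move: dx; rewrite pi => dx ki; split; first lra.
rewrite /gp /gromov_product sig_isometry; have := t_le; lra.
Qed.

Let sep z z' j : ~~ V j z -> t + delta <= gp z' (sig j o) ->
  mdist z o + mdist z' o - 2 * t - 2 * delta <= mdist z z'.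
Proof.
rewrite /V -ltNge => Vz gz'; rewrite (mdist_gromov_product o z z') -/(gp _ _).
have [|zz'] := leP (gp z z') (t + delta); first by lra.
have : t + delta - delta <= gp z (sig j o).
  by apply: (hyperbolic_atP (y := z') hyp) => //; exact: ltW.
lra.
Qed.

Let e_le x y c : c <= mdist x y -> e x y <= expR (- (al * c)).
Proof. by move=> cxy; rewrite ler_expR lerN2 ler_pM2l. Qed.

Let one_sided i j x y : U i x -> ~~ U j y -> ~~ V j (sig i x) ->
  e (sig i x) (sig j y) <= ep * (e x (pre i) * e y o).
Proof.
move=> Ux /notU[y1 y2] Vx; have := sep Vx y2; rewrite sig_mdist => d.
apply: le_trans (e_le d) _.
rewrite /ep /e -!expRD ler_expR -!opprD lerN2 -!mulrDr ler_pM2l//.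
have := t_le; lra.
Qed.

Let le_sum6 (E a1 a2 a3 b1 b2 b3 : R) : 0 <= a1 -> 0 <= a2 -> 0 <= a3 ->
  0 <= b1 -> 0 <= b2 -> 0 <= b3 ->
  [|| E <= a1, E <= a2, E <= a3, E <= b1, E <= b2 | E <= b3] ->
  E <= a1 + a2 + a3 + (b1 + b2 + b3).
Proof. by move=> ? ? ? ? ? ? /or4P[?|?|?|/or3P[]?]; lra. Qed.

(** The three indicator terms are the configurations where ping-pong gives nothing. Each puts a
    point in a repelling shadow, and disjointness of shadows will make their total of order [q]
    instead of [q^2]. *)
Let pointwise i j x y : i != j -> e (sig i x) (sig j y) <=
  ep * (e x o * e y o + e x (pre i) * e y o + e x o * e y (pre j))
  + ((U i x && U j y)%:R * e (sig i x) (sig j y)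
  + (U i x && V j (sig i x))%:R * e (sig i x) (sig j y)
  + (U j y && V i (sig j y))%:R * e (sig i x) (sig j y)).
Proof.
move=> ij.
rewrite !mulrDr; apply: le_sum6; try by rewrite !mulr_ge0 ?expR_ge0.
have [Ux|Ux] := boolP (U i x); have [Uy|Uy] := boolP (U j y).
- by rewrite mul1r lexx !orbT.
- have [Vx|Vx] := boolP (V j (sig i x)); first by rewrite mul1r lexx !orbT.
  by rewrite one_sided// !orbT.
- have [Vy|Vy] := boolP (V i (sig j y)); first by rewrite mul1r lexx !orbT.
  suff -> : e (sig i x) (sig j y) <= ep * (e x o * e y (pre j)) by rewrite !orbT.
  by rewrite /e metric_sym [_ * expR (- (al * mdist y _))]mulrC; exact: one_sided.
- have [x1 x2] := notU Ux; have [y1 y2] := notU Uy.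
  have Vx : ~~ V j (sig i x).
    apply/negP => /(V_inj (i := i)) ji; rewrite ji ?eqxx// in ij.
    by rewrite /V (le_trans _ x2)// lerDl.
  have := sep Vx y2 => d.
  suff -> : e (sig i x) (sig j y) <= ep * (e x o * e y o) by [].
  apply: le_trans (e_le d) _.
  rewrite /ep /e -!expRD ler_expR -!opprD lerN2 -!mulrDr ler_pM2l//.
  have := t_le; have := delta0; lra.
Qed.

Let kern_filter (f g : X -> X) (P Q : pred X) l :
  kern al (map f (seq.filter P l)) (map g (seq.filter Q l)) =
  \sum_(x <- l) \sum_(y <- l) (P x && Q y)%:R * e (f x) (g y).
Proof.
rewrite /kern big_map big_filter big_mkcond; apply: eq_bigr => x _.
rewrite big_map; case: (P x) => /=; last by rewrite big1// => y _; rewrite mul0r.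
rewrite big_filter big_mkcond; apply: eq_bigr => y _.
by case: (Q y); rewrite ?mul1r ?mul0r.
Qed.

Let kern_map_filter (f : X -> X) (P : pred X) l :
  (forall x y, mdist (f x) (f y) = mdist x y) ->
  kern al (map f (seq.filter P l)) (map f (seq.filter P l)) =
  \sum_(x <- l) \sum_(y <- l) (P x && P y)%:R * e x y.
Proof.
move=> fi; rewrite kern_filter; apply: eq_bigr => x _; apply: eq_bigr => y _.
by rewrite /e fi.
Qed.

Let kern_disjoint (I : finType) (P : I -> pred X) l :
  (forall i j x, P i x -> P j x -> i = j) ->
  \sum_i \sum_(x <- l) \sum_(y <- l) (P i x && P i y)%:R * e x y <= kern al l l.
Proof.
move=> Pinj; rewrite exchange_big/= /kern; apply: ler_sum => x _.
rewrite exchange_big/=; apply: ler_sum => y _; rewrite -mulr_suml.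
apply: ler_piMl; first exact: expR_ge0.
by apply: sum_indicator_le1 => i j /andP[+ _] /andP[+ _]; exact: Pinj.
Qed.

Let B := kern_const al delta.
Let B0 : 0 <= B. Proof. exact: expR_ge0. Qed.

Let amgm c (l l' : seq X) : 0 < c ->
  kern al l l' <= B / 2 * (c * kern al l l + c^-1 * kern al l' l').
Proof. by move=> c0; have := kern_amgm al0 l l' hyp c0; rewrite -/B; lra. Qed.

(** Almost Cauchy-Schwarz with weight [1] for each pair [(i, j)]. Every [D i] is met [2 q] times,
    and the [D i] together are at most the kernel of [l] because the [U i] are disjoint. *)
Let sumUU (l : seq X) : \sum_i \sum_j \sum_(x <- l) \sum_(y <- l)
   (U i x && U j y)%:R * e (sig i x) (sig j y) <= B * q%:R * kern al l l.
Proof.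
under eq_bigr do under eq_bigr do rewrite -kern_filter.
pose D i := \sum_(x <- l) \sum_(y <- l) (U i x && U i y)%:R * e x y.
apply: (@le_trans _ _ (\sum_(i < q) \sum_(j < q) B / 2 * (D i + D j))).
  apply: ler_sum => i _; apply: ler_sum => j _.
  have := amgm (map (sig i) (seq.filter (U i) l)) (map (sig j) (seq.filter (U j) l)) ltr01.
  by rewrite invr1 !mul1r !kern_map_filter//.
have -> : \sum_(i < q) \sum_(j < q) B / 2 * (D i + D j) = B * q%:R * \sum_(i < q) D i.
  under eq_bigr do rewrite -mulr_sumr big_split/= sumr_const card_ord.
  rewrite -mulr_sumr big_split/= sumr_const card_ord sumrMnl -[_ *+ q]mulr_natl.
  by field.
by rewrite ler_wpM2l ?mulr_ge0//; apply: kern_disjoint => i j x; exact: U_inj.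
Qed.

(** Here one of the two lists is all of [l], charged for each of the [q^2] pairs, while the sets
    [P (i, j)] are disjoint over all pairs and cost one kernel in total. The weight [q] in almost
    Cauchy-Schwarz balances the two sides. *)
Let sumUV (l : seq X) : (0 < q)%N -> \sum_i \sum_j \sum_(x <- l) \sum_(y <- l)
   (U i x && V j (sig i x))%:R * e (sig i x) (sig j y) <= B * q%:R * kern al l l.
Proof.
move=> q0; have q0' : 0 < q%:R :> R by rewrite ltr0n.
pose P (ij : 'I_q * 'I_q) x := U ij.1 x && V ij.2 (sig ij.1 x).
pose D ij := \sum_(x <- l) \sum_(y <- l) (P ij x && P ij y)%:R * e x y.
apply: (@le_trans _ _ (\sum_(i < q) \sum_(j < q)
    B / 2 * (q%:R * D (i, j) + q%:R^-1 * kern al l l))).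
  apply: ler_sum => i _; apply: ler_sum => j _.
  have := amgm (map (sig i) (seq.filter (P (i, j)) l)) (map (sig j) (seq.filter xpredT l)) q0'.
  rewrite kern_map_filter// filter_predT (@kern_map_isometry _ _ _ (sig j))//.
  rewrite -[X in map (sig j) X](filter_predT l) kern_filter.
  by under eq_bigr do under eq_bigr do rewrite andbT.
have -> : \sum_(i < q) \sum_(j < q) B / 2 * (q%:R * D (i, j) + q%:R^-1 * kern al l l) =
    B * q%:R / 2 * (\sum_ij D ij + kern al l l).
  under eq_bigr do rewrite -mulr_sumr big_split/= sumr_const card_ord -mulr_sumr
    -[(_ * _) *+ q]mulr_natl mulVKf ?gt_eqF//.
  rewrite -mulr_sumr big_split/= sumr_const card_ord -mulr_sumr.
  rewrite pair_big/= (eq_bigr D) => [|[]//].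
  by rewrite -[kern _ _ _ *+ q]mulr_natl; field.
have : \sum_ij D ij <= kern al l l.
  apply: kern_disjoint => -[i j] [i' j'] x /andP[/= Ui Vj] /andP[/= Ui' Vj'].
  have ii' := U_inj Ui Ui'; rewrite -ii' in Vj' *; by rewrite (V_inj Vj Vj').
have : 0 <= B * q%:R / 2 by rewrite !mulr_ge0// invr_ge0.
nra.
Qed.

Definition sweep (l : seq X) : seq X := flatten [seq map (sig i) l | i <- enum 'I_q].

(** Diagonal pairs give [q], each of the three exceptional families at most [B q], and pairs in
    general position [3 q^2 ep]. *)
Lemma kern_sweep l : (0 < q)%N -> kern al (sweep l) (sweep l) <=
  (q%:R * (1 + 3 * B) + 3 * q%:R ^+ 2 * ep) * kern al l l.
Proof.
move=> q0.
have big_sweep (F : X -> R) : \sum_(z <- sweep l) F z = \sum_i \sum_(x <- l) F (sig i x).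
  rewrite /sweep big_flatten big_map big_enum/=.
  by apply: eq_bigr => i _; rewrite big_map.
rewrite {1}/kern big_sweep.
under eq_bigr do under eq_bigr do rewrite big_sweep.
under eq_bigr do rewrite exchange_big/=.
pose T1 i j x y : R := (U i x && U j y)%:R * e (sig i x) (sig j y).
pose T2 i j x y : R := (U i x && V j (sig i x))%:R * e (sig i x) (sig j y).
pose T3 i j x y : R := (U j y && V i (sig j y))%:R * e (sig i x) (sig j y).
pose T0 i j x y := e x o * e y o + e x (pre i) * e y o + e x o * e y (pre j).
have e0 z w : 0 <= e z w by exact: expR_ge0.
apply: (@le_trans _ _ (\sum_i \sum_j \sum_(x <- l) \sum_(y <- l)
   ((i == j)%:R * e x y + (ep * T0 i j x y + (T1 i j x y + T2 i j x y + T3 i j x y))))).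
  apply: ler_sum => i _; apply: ler_sum => j _.
  apply: ler_sum => x _; apply: ler_sum => y _.
  have [<-|ij] := eqVneq i j; last by rewrite mul0r add0r; exact: pointwise.
  rewrite sig_isometry mul1r lerDl !addr_ge0 ?mulr_ge0 ?addr_ge0 ?expR_ge0//;
    by rewrite mulr_ge0.
under eq_bigr do under eq_bigr do under eq_bigr do rewrite 2!big_split/= 2!big_split/=.
under eq_bigr do under eq_bigr do rewrite 2!big_split/= 2!big_split/=.
under eq_bigr do rewrite 2!big_split/= 2!big_split/=.
rewrite 2!big_split/= 2!big_split/=.
have S3 : \sum_i \sum_j \sum_(x <- l) \sum_(y <- l) T3 i j x y <= B * q%:R * kern al l l.
  rewrite exchange_big/=; under eq_bigr do under eq_bigr do rewrite exchange_big/=.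
  apply: le_trans (sumUV l q0); apply: ler_sum => i _; apply: ler_sum => j _.
  apply: ler_sum => x _; apply: ler_sum => y _.
  by rewrite /T3 /e metric_sym.
have S0 : \sum_(i < q) \sum_(j < q) \sum_(x <- l) \sum_(y <- l) ((i == j)%:R * e x y)
    = q%:R * kern al l l.
  rewrite mulr_natl -[q in RHS]card_ord -sumr_const; apply: eq_bigr => i _.
  rewrite (bigD1 i)//= [X in _ + X]big1 ?addr0 => [|j ji]; last first.
    by rewrite big1// => x _; rewrite big1// => y _; rewrite eq_sym (negbTE ji) mul0r.
  by apply: eq_bigr => x _; apply: eq_bigr => y _; rewrite eqxx mul1r.
have SE : \sum_i \sum_j \sum_(x <- l) \sum_(y <- l) (ep * T0 i j x y)
    <= 3 * q%:R ^+ 2 * ep * kern al l l.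
  have -> : 3 * q%:R ^+ 2 * ep * kern al l l = \sum_(i < q) \sum_(j < q) ep * (3 * kern al l l).
    by rewrite !sumr_const !card_ord -mulrnA -[_ *+ (q * q)]mulr_natl natrM; ring.
  apply: ler_sum => i _; apply: ler_sum => j _.
  under eq_bigr do rewrite -mulr_sumr.
  rewrite -mulr_sumr ler_wpM2l ?expR_ge0//.
  under eq_bigr do rewrite 2!big_split/=.
  rewrite 2!big_split/=.
  have P z w : \sum_(x <- l) \sum_(y <- l) e x z * e y w <= kern al l l.
    apply: le_trans (sum_expR_mul_le_kern al0 l z w).
    by rewrite mulr_suml; apply: ler_sum => x _; rewrite mulr_sumr.
  have := P o o; have := P (pre i) o; have := P o (pre j); lra.
have := sumUU l; have := sumUV l q0.
rewrite S0; move: S3 SE; rewrite /T1 /T2 /T3; lra.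
Qed.

End contraction.

(** * Schottky families in acylindrical actions *)

Lemma affine_lt_expn2 (R : realType) (A B : R) :
  exists k : nat, A + B * k%:R < (2 ^ k)%:R.
Proof.
pose j := (Num.truncn (`|A| + 2 * `|B|)).+1.
have jgt : `|A| + 2 * `|B| < j%:R by exact: truncnS_gt.
have jn : (1 : R) <= j%:R by rewrite ler1n.
exists (2 * j)%N.
rewrite expnM natrX.
have e2 : (j%:R : R) ^+ 2 <= (2 ^ 2)%:R ^+ j.
  by rewrite -!natrX ler_nat -expnM mulnC expnM leq_exp2r// ltnW// ltn_expl.
apply: lt_le_trans e2; rewrite natrM expr2.
have A0 := ler_norm A; have B0 := ler_norm B.
have nA := normr_ge0 A; have nB := normr_ge0 B.
nra.
Qed.

Lemma four_points (R : realType) (X : metricType R) (delta : R) :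
  (forall o : X, hyperbolic_at delta o) -> forall x y z w : X,
  mdist x z + mdist y w <= mdist x y + mdist z w + 2 * delta \/
  mdist x z + mdist y w <= mdist y z + mdist x w + 2 * delta.
Proof.
move=> hyp x y z w; have := hyp w x y z.
rewrite lerBlDr ge_min /gromov_product => /orP[] h; [left|right];
  move: h; rewrite -?lerBlDr; lra.
Qed.

(** * Growth of the displacement along the powers of an element *)

Section growth.
Context {R : realType}.
Variables (delta : R) (psi : nat -> R).
Hypothesis delta0 : 0 <= delta.
Hypothesis psi0 : psi 0 = 0.
Hypothesis psiD : forall m n, psi (m + n)%N <= psi m + psi n.
Hypothesis psi4 : forall p n m,
  psi (p + n)%N + psi (n + m)%N <= psi p + psi m + 2 * delta \/
  psi (p + n)%N + psi (n + m)%N <= psi n + psi (p + n + m)%N + 2 * delta.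
Hypothesis psi2 : psi 1 + 4 * delta + 1 <= psi 2.

(** Local-to-global principle. In the four-point inequality for steps [j], [1], [1], the first
    alternative would make [psi] decrease from [j] to [j.+1], against the induction; the second
    transfers the gain between [psi 1] and [psi 2] to the next step. *)
Lemma growth_incr j : psi j + (2 * delta + 1) <= psi j.+1.
Proof.
have d0 := delta0; have p2 := psi2.
elim: j => [|j IH]; first by have := psiD 1 1; rewrite psi0; lra.
by have := psi4 j 1 1; rewrite !addn1; case; lra.
Qed.

Lemma growth_mono i j : (i <= j)%N -> psi i <= psi j.
Proof.
elim: j => [|j IH]; first by rewrite leqn0 => /eqP ->.
have := growth_incr j; have d0 := delta0; rewrite leq_eqVlt ltnS => h /orP[/eqP->//|/IH]; lra.
Qed.

Lemma growth_lt i j : psi i < psi j -> (i < j)%N.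
Proof. by move=> h; rewrite ltnNge; apply/negP => /growth_mono; rewrite leNgt h. Qed.

Lemma growth_ge j : j%:R <= psi j.
Proof.
have d0 := delta0.
by elim: j => [|j IH]; rewrite ?psi0//; have := growth_incr j; rewrite -natr1; lra.
Qed.

(** The orbit is almost geodesic: in the four-point inequality with middle step [1], [growth_incr]
    excludes the first alternative, and the middle step costs [2 psi 1]. *)
Lemma growth_superadd p m : psi p + psi m <= psi (p + m)%N + (2 * psi 1 + 2 * delta).
Proof.
have d0 := delta0; have := growth_incr p; have := growth_incr m.
have := psiD (p + m) 1; have := psi4 p 1 m.
by rewrite (addnC 1) (addnAC p) !addn1; case; lra.
Qed.

End growth.

Section action.
Context {R : realType} {G : groupType} {X : metricType R}.
Variables (act : G -> X -> X) (o : X) (delta : R).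
Hypothesis isom : isometric_action act.
Hypothesis delta0 : 0 <= delta.
Hypothesis hyp : forall o : X, hyperbolic_at delta o.

Lemma mdist_act g x y : mdist (act g x) (act g y) = mdist x y.
Proof. exact: act_isometry. Qed.

Lemma act_mulg g h x : act (g * h)%g x = act g (act h x).
Proof. exact: act_mul. Qed.

Lemma actK g : cancel (act g) (act g^-1%g).
Proof. by move=> x; rewrite -act_mulg mulVg (act_one isom). Qed.

Lemma mdist_act_inv g x : mdist (act g^-1%g x) x = mdist (act g x) x.
Proof.
by rewrite -(mdist_act g) -act_mulg mulgV (act_one isom) metric_sym.
Qed.

Lemma gromov_product_act g x y z :
  gromov_product (act g z) (act g x) (act g y) = gromov_product z x y.
Proof. by rewrite /gromov_product !mdist_act. Qed.

Definition displ (g : G) (n : nat) : R := mdist (act (g ^+ n)%g o) o.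

Lemma displ0 g : displ g 0 = 0.
Proof. by rewrite /displ expg0 (act_one isom) mdistxx. Qed.

Lemma mdist_expg g i n :
  mdist (act (g ^+ (i + n))%g o) (act (g ^+ i)%g o) = displ g n.
Proof. by rewrite expgnDr act_mulg mdist_act. Qed.

Lemma mdist_expg' g i n :
  mdist (act (g ^+ i)%g o) (act (g ^+ (i + n))%g o) = displ g n.
Proof. by rewrite metric_sym mdist_expg. Qed.

Lemma displD g m n : displ g (m + n) <= displ g m + displ g n.
Proof.
by rewrite addrC -(mdist_expg g m n); exact: metric_triangle.
Qed.

Lemma displ4 g p n m :
  displ g (p + n)%N + displ g (n + m)%N <= displ g p + displ g m + 2 * delta \/
  displ g (p + n)%N + displ g (n + m)%N <= displ g n + displ g (p + n + m)%N + 2 * delta.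
Proof.
have := four_points hyp o (act (g ^+ p)%g o) (act (g ^+ (p + n))%g o)
  (act (g ^+ (p + n + m))%g o).
by rewrite !(metric_sym o) -addnA !mdist_expg' addnA mdist_expg'.
Qed.

Lemma displV g n : displ g^-1%g n = displ g n.
Proof. by rewrite /displ expVgn mdist_act_inv. Qed.

Definition strongly_displaced g := displ g 1 + 4 * delta + 1 <= displ g 2.

(** If every power failed, doubling the exponent would add at most [4 delta + 1] to the
    displacement, so [a ^+ (2 ^ k)] would move [o] by an amount affine in [k], whereas a loxodromic
    element moves it by at least a multiple of [2 ^ k], up to a constant. *)
Lemma loxodromic_strongly_displaced a : loxodromic act a ->
  exists2 l : nat, (0 < l)%N & strongly_displaced (a ^+ l)%g.
Proof.
move=> /(_ o)[lam [c [lam1 c0 lox]]].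
apply: contrapT => /forall2NP weak.
have {}weak l : (0 < l)%N -> displ a (l * 2) <= displ a l + (4 * delta + 1).
  move=> l0; case: (weak l) => // /negP; rewrite /strongly_displaced /displ.
  rewrite -!expgnA muln1 -ltNge; lra.
have dbl k : displ a (2 ^ k) <= displ a 1 + (4 * delta + 1) * k%:R.
  elim: k => [|k IH]; first by rewrite expn0 mulr0 addr0.
  have := weak (2 ^ k)%N; rewrite expn_gt0/= -expnSr => /(_ isT).
  rewrite -natr1; lra.
have lam0 : 0 < lam by exact: lt_le_trans lam1.
have [k] := affine_lt_expn2 (lam * (displ a 1 + c)) (lam * (4 * delta + 1)).
have := lox (Posz (2 ^ k)) (Posz 0); rewrite /= expg0 (act_one isom) => /andP[+ _].
rewrite -/(displ a (2 ^ k)) subr0 ger0_norm// -pmulrn.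
set z := (2 ^ k)%:R.
move=> lo; apply/negP; rewrite -leNgt.
have : lam^-1 * z <= displ a 1 + (4 * delta + 1) * k%:R + c.
  by have := dbl k; lra.
rewrite -(ler_pM2l lam0) mulVKf ?gt_eqF//; lra.
Qed.

Section commute.
Variable g h : G.
Hypothesis acyl : acylindrical act.
Hypothesis gd : strongly_displaced g.

Let psiD := displD g.
Let psi4 := displ4 g.
Let psi_mono := growth_mono delta0 (displ0 g) psiD psi4 gd.
Let psi_lt := growth_lt delta0 (displ0 g) psiD psi4 gd.
Let psi_ge := growth_ge delta0 (displ0 g) psiD psi4 gd.
Let psi_sup := growth_superadd delta0 (displ0 g) psiD psi4 gd.
Let kap := 2 * displ g 1 + 2 * delta.
Let eta := mdist (act h o) o.

(** The chain [g^i o], [g^n o], [h g^n o], [h g^i o] has consecutive Gromov products at least about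
    [displ g i], and its two ends are at that distance from [o] up to [eta]; two uses of
    hyperbolicity make them close. *)
Let fellow n i : displ g i <= gromov_product o (act (g ^+ n)%g o) (act h (act (g ^+ n)%g o)) ->
  (i <= n)%N ->
  mdist (act (g ^+ i)%g o) (act h (act (g ^+ i)%g o)) <= 3 * eta + kap + 4 * delta.
Proof.
set x := fun j => act (g ^+ j)%g o; rewrite -/(x n) -/(x i) => long lein.
have eta0 : 0 <= eta by exact: mdist_ge0.
have kap0 : 0 <= kap.
  by have := mdist_ge0 (act (g ^+ 1)%g o) o; have := delta0; rewrite /kap /displ; lra.
have xo j : mdist (x j) o = displ g j by [].
have xin : mdist (x i) (x n) = displ g (n - i) by rewrite /x -{1}(subnKC lein) mdist_expg'.
have gin : displ g i - kap / 2 <= gromov_product o (x i) (x n).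
  have := psi_sup i (n - i); rewrite subnKC// -/kap.
  rewrite /gromov_product xin !xo; lra.
have hgin : displ g i - kap / 2 - eta <= gromov_product o (act h (x n)) (act h (x i)).
  have := gromov_product_basepoint (act h o) o (act h (x n)) (act h (x i)).
  rewrite gromov_product_act -/eta gromov_productC; lra.
have T : displ g i - kap / 2 - eta - delta - delta <= gromov_product o (x i) (act h (x i)).
  apply: (hyperbolic_atP (y := x n) (hyp o)).
    by have := delta0; lra.
  apply: (hyperbolic_atP (y := act h (x n)) (hyp o)) => //; lra.
have := mdist_gromov_product o (x i) (act h (x i)).
have := metric_triangle (act h (x i)) (act h o) o; rewrite mdist_act -/eta !xo.
lra.
Qed.

(* If [h] quasi-fixed the forward end of [g], the conjugates [g^-j h g^j] would
   move two far away points of the orbit of [g] by a bounded amount, so two of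
   them would coincide. *)
Lemma commute_or_bounded :
  (exists2 p : nat, (0 < p)%N & (g ^+ p * h = h * g ^+ p)%g) \/
  (exists rho : R, forall n : nat,
     gromov_product o (act (g ^+ n)%g o) (act h (act (g ^+ n)%g o)) <= rho).
Proof.
have eta0 : 0 <= eta by exact: mdist_ge0.
have r0 : 0 <= 3 * eta + kap + 4 * delta.
  have := mdist_ge0 (act (g ^+ 1)%g o) o; have := delta0.
  rewrite /kap /displ; lra.
have [D [N [D0 cardN]]] := acyl r0.
pose M := (Num.truncn D).+1.
have DM : D <= displ g M.
  by apply: le_trans (psi_ge M); rewrite ltW// truncnS_gt.
(* The conjugate [f j] moves [o] as [h] moves [g^j o], and [g^M o] as [h] moves [g^(j+M) o]. With
   [j <= N], indices up to [N + M] must fellow-travel, and there are [N + 1] conjugates for at most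
   [N] group elements. *)
have [[n nlong]|bounded] := pselect (exists n, displ g (N + M) <
    gromov_product o (act (g ^+ n)%g o) (act h (act (g ^+ n)%g o))); last first.
  right; exists (displ g (N + M)) => n; rewrite leNgt; apply/negP => h'.
  by apply: bounded; exists n.
left.
have close i : (i <= N + M)%N ->
    mdist (act (g ^+ i)%g o) (act h (act (g ^+ i)%g o)) <= 3 * eta + kap + 4 * delta.
  move=> iNM; apply: (@fellow n).
    by rewrite (le_trans (psi_mono iNM))// ltW.
  rewrite ltnW//; apply: psi_lt; apply: le_lt_trans (psi_mono iNM) _.
  exact: lt_le_trans nlong (gromov_product_le_mdist _ _ _).
pose f j := (g ^- j * h * g ^+ j)%g.
have fE j x : mdist x (act (f j) x) =
    mdist (act (g ^+ j)%g x) (act h (act (g ^+ j)%g x)).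
  by rewrite -[in RHS](mdist_act (g ^- j)%g) actK /f !act_mulg.
have [inj|] := pselect (forall i j, (i <= N)%N -> (j <= N)%N -> f i = f j -> i = j).
  have : (`I_N.+1 #<= `I_N)%card.
    have finj : {in `I_N.+1 &, injective f}.
      by move=> i j; rewrite !inE/= => iN jN; exact: inj.
    have := inj_card_eq finj; rewrite card_eq_le => /andP[_ le1].
    apply: card_le_trans le1 _.
    have far : D <= mdist o (act (g ^+ M)%g o) by rewrite metric_sym.
    apply: card_le_trans (subset_card_le _) (cardN _ _ far).
    move=> _ [j /= jN <-]; rewrite !fE; split.
      by apply: close; rewrite ltnS in jN; rewrite (leq_trans jN)// leq_addr.
    rewrite -act_mulg -expgnDr; apply: close.
    by rewrite leq_add2r -ltnS.
  by rewrite card_le_II ltnn.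
move=> /existsNP[i /existsNP[j /not_implyP[iN /not_implyP[jN /not_implyP[fij ij]]]]].
wlog ltij : i j iN jN fij ij / (i < j)%N.
  move=> H; have [ltij|ltji|//] := ltngtP i j; first exact: H ltij.
  by apply: (H j i) => //; exact: nesym.
exists (j - i)%N; first by rewrite subn_gt0.
rewrite /f -(subnKC (ltnW ltij)) in fij; set p := (j - i)%N in fij *.
move: fij; rewrite (addnC i) expgnDr invgM -!mulgA => /mulgI.
rewrite !mulgA => /mulIg hE.
by rewrite {1}hE -!mulgA mulVKg.
Qed.

End commute.
End action.

Lemma gromov_product_perturb (R : realType) (X : metricType R) (o x y x' y' : X) :
  gromov_product o x y <= gromov_product o x' y' + mdist x x' + mdist y y'.
Proof.
have := metric_triangle x x' o; have := metric_triangle y y' o.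
have := metric_triangle x' x y'; have := metric_triangle x y y'.
by rewrite /gromov_product (metric_sym x' x); lra.
Qed.

Lemma freely_generate_not_commute (G : groupType) (a b : G) :
  freely_generate a b -> forall p m, (0 < p)%N -> (0 < m)%N ->
  (a ^+ p * b ^+ m <> b ^+ m * a ^+ p)%g.
Proof.
move=> free [//|p] [//|m] _ _ comm.
(* The commutator of [a ^+ p.+1] and [b ^+ m.+1], a reduced word. *)
pose w := nseq p.+1 (true, false) ++ nseq m.+1 (false, false) ++
          nseq p.+1 (true, true) ++ nseq m.+1 (false, true).
have prod_nseq n l : (\prod_(l' <- nseq n l) letter a b l' = letter a b l ^+ n)%g.
  by elim: n => [|n IH]; rewrite /= ?big_nil// big_cons IH -expgS.
apply: (free w) => //.
  have last_nseq (x : bool * bool) n : last x (nseq n x) = x by elim: n.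
  have path_nseq (e : rel (bool * bool)) (x : bool * bool) n : e x x -> path e x (nseq n x).
    by move=> exx; elim: n => //= n ->; rewrite exx.
  by rewrite /reduced_word /w; do 4 rewrite /= ?cat_path ?last_nseq ?path_nseq.
rewrite /w !big_cat !prod_nseq /letter/= !mulgA comm !expVgn.
by rewrite mulgK mulgV.
Qed.

Section schottky.
Context {R : realType} {G : groupType} {X : metricType R}.
Variables (act : G -> X -> X) (o : X) (delta : R) (a b : G).
Hypothesis isom : isometric_action act.
Hypothesis acyl : acylindrical act.
Hypothesis delta0 : 0 <= delta.
Hypothesis hyp : forall o : X, hyperbolic_at delta o.
Hypothesis lox : loxodromic act a.
Hypothesis free : freely_generate a b.

Let gp_mul c h x :
  gromov_product o (act c x) (act (c * h)%g x) <=
  gromov_product o x (act h x) + mdist (act c o) o.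
Proof.
rewrite (act_mulg isom).
have := gromov_product_basepoint o (act c o) (act c x) (act c (act h x)).
by rewrite (gromov_product_act isom) metric_sym.
Qed.

(** Freeness prevents powers of [b] from commuting with powers of [g = a^l], so [g^n o] and
    [b^m g^n o] diverge, with a bound independent of [n], for each [0 < m <= q]; the same holds for
    [g^-1], which governs the inverses. As [tau] precedes [k], the displacement can later be taken
    large compared with [tau]. The right factor [b^(q-i)] equalizes the word lengths. *)
Lemma schottky_family (q : nat) : exists (l : nat) (tau : R), forall k : R,
  exists n : nat,
  let s (i : 'I_q) := (b ^+ i * (a ^+ l) ^+ n * b ^+ (q - i))%g in
  [/\ forall i j, i != j ->
        gromov_product o (act (s i) o) (act (s j) o) <= tau,
      forall i j, i != j ->
        gromov_product o (act (s i)^-1%g o) (act (s j)^-1%g o) <= tau &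
      forall i, k <= mdist (act (s i) o) o].
Proof.
have [l l0 gd] := loxodromic_strongly_displaced o delta isom lox.
set g := (a ^+ l)%g in gd.
have gdV : strongly_displaced act o delta g^-1%g.
  by rewrite /strongly_displaced !(displV _ isom).
have notc p m : (0 < p)%N -> (0 < m)%N -> (g ^+ p * b ^+ m <> b ^+ m * g ^+ p)%g.
  move=> p0 m0; rewrite /g -expgnA; apply: freely_generate_not_commute => //.
  by rewrite muln_gt0 l0.
have /choice[rho rhoP] : forall m : 'I_q, exists r : R, forall n,
    gromov_product o (act (g ^+ n)%g o) (act (b ^+ m.+1)%g (act (g ^+ n)%g o)) <= r /\
    gromov_product o (act (g^-1 ^+ n)%g o) (act (b ^+ m.+1)%g (act (g^-1 ^+ n)%g o)) <= r.
  move=> m.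
  have [[p p0 /notc]|[r1 r1P]] := commute_or_bounded isom delta0 hyp (b ^+ m.+1)%g acyl gd.
    by move=> /(_ p0 isT).
  have [[p p0]|[r2 r2P]] := commute_or_bounded isom delta0 hyp (b ^+ m.+1)%g acyl gdV.
    rewrite expVgn => comm; case: (@notc p m.+1 p0 isT).
    apply: (mulgI (g ^- p)%g); apply: (mulIg (g ^- p)%g).
    by rewrite mulKg !mulgA mulgK comm.
  exists (Num.max r1 r2) => n; rewrite !le_max r1P r2P orbT; split=> //.
pose r := \sum_m `|rho m|.
have rP (m : 'I_q) : rho m <= r.
  by apply: le_trans (ler_norm _) _; apply: (ler_sum_mem (F := fun m => `|rho m|));
    rewrite // mem_index_enum.
pose beta := \sum_(i < q.+1) displ act o b i.
have betaP i : (i <= q)%N -> displ act o b i <= beta.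
  rewrite -ltnS => iq.
  apply: (ler_sum_mem (F := fun i : 'I_q.+1 => displ act o b i) _ (y := Ordinal iq)).
    by move=> z; exact: mdist_ge0.
  by rewrite mem_index_enum.
(* One [beta] for the change of base point by a power of [b], two for replacing the orbit points of
   [s i] and [s j] by nearby ones. *)
exists l, (r + 3 * beta) => k.
pose n := (Num.truncn (k + 2 * beta)).+1.
exists n => s.
have sn i : mdist (act (s i) o) (act (b ^+ i)%g (act (g ^+ n)%g o)) <= beta.
  by rewrite /s !(act_mulg isom) !(mdist_act isom) betaP// leq_subr.
have sVn i : mdist (act (s i)^-1%g o) (act (b ^- (q - i))%g (act (g^-1 ^+ n)%g o)) <= beta.
  rewrite /s !invgM !(act_mulg isom) (mdist_act isom) expVgn (mdist_act isom).
  by rewrite (mdist_act_inv isom) betaP// ltnW.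
have bound (x : X) c m (i j : 'I_q) : (i < j)%N -> m = (j - i)%N ->
   mdist (act c o) o <= beta ->
   gromov_product o x (act (b ^+ m)%g x) <= r ->
   gromov_product o (act c x) (act (c * b ^+ m)%g x) <= r + beta.
  by move=> ij mE cb rx; apply: le_trans (gp_mul _ _ _) _; rewrite lerD.
have rb (i j : 'I_q) : (i < j)%N ->
    gromov_product o (act (g ^+ n)%g o) (act (b ^+ (j - i))%g (act (g ^+ n)%g o)) <= r /\
    gromov_product o (act (g^-1 ^+ n)%g o) (act (b ^+ (j - i))%g (act (g^-1 ^+ n)%g o)) <= r.
  move=> ij; have mq : ((j - i).-1 < q)%N by have := ltn_ord j; lia.
  have := rhoP (Ordinal mq) n; have := rP (Ordinal mq).
  rewrite /= prednK ?subn_gt0// => rr [r1 r2].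
  by split; exact: le_trans rr.
split=> [i j|i j|i].
- wlog ij : i j / (i < j)%N.
    move=> H ij; have [lt|lt|eq] := ltngtP i j; first exact: H.
      by rewrite gromov_productC; apply: H lt _; rewrite eq_sym.
    by rewrite (val_inj eq) eqxx in ij.
  move=> _; have [rx _] := rb _ _ ij.
  have := bound (act (g ^+ n)%g o) (b ^+ i)%g _ i j ij erefl (betaP _ (ltnW (ltn_ord i))) rx.
  rewrite -expgnDr subnKC ?(ltnW ij)//.
  have := gromov_product_perturb o (act (s i) o) (act (s j) o)
    (act (b ^+ i)%g (act (g ^+ n)%g o)) (act (b ^+ j)%g (act (g ^+ n)%g o)).
  have := sn i; have := sn j; lra.
- wlog ij : i j / (i < j)%N.
    move=> H ij; have [lt|lt|eq] := ltngtP i j; first exact: H.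
      by rewrite gromov_productC; apply: H lt _; rewrite eq_sym.
    by rewrite (val_inj eq) eqxx in ij.
  move=> _; have [_ rx] := rb _ _ ij.
  have cb : mdist (act (b ^- (q - i))%g o) o <= beta.
    by rewrite (mdist_act_inv isom) betaP// leq_subr.
  have := bound (act (g^-1 ^+ n)%g o) (b ^- (q - i))%g _ i j ij erefl cb rx.
  have -> : (b ^- (q - i) * b ^+ (j - i) = b ^- (q - j))%g.
    have -> : (q - i = (j - i) + (q - j))%N by have := ltn_ord j; lia.
    by rewrite expgnDr invgM mulgVK.
  have := gromov_product_perturb o (act (s i)^-1%g o) (act (s j)^-1%g o)
    (act (b ^- (q - i))%g (act (g^-1 ^+ n)%g o)) (act (b ^- (q - j))%g (act (g^-1 ^+ n)%g o)).
  have := sVn i; have := sVn j; lra.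
- have gn : n%:R <= displ act o g n.
    apply: (growth_ge delta0 (displ0 _ isom g) (displD _ isom g)) => //.
    exact: displ4.
  have kn : k + 2 * beta < n%:R by exact: truncnS_gt.
  have := sn i; have := betaP _ (ltnW (ltn_ord i)).
  have := metric_triangle (act (b ^+ i)%g (act (g ^+ n)%g o)) (act (b ^+ i)%g o) o.
  have := metric_triangle (act (b ^+ i)%g (act (g ^+ n)%g o)) (act (s i) o) o.
  have := metric_triangle (act (b ^+ i)%g (act (g ^+ n)%g o)) o (act (b ^+ i)%g o).
  rewrite (mdist_act isom) (metric_sym (act _ (act _ o)) (act (s i) o)).
  rewrite (metric_sym o (act (b ^+ i)%g o)).
  move: gn; rewrite /displ; lra.
Qed.

End schottky.

(** * Expectations along words of increments *)

Section esum_extra.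
Context {R : realType}.
Local Open Scope ereal_scope.

Lemma esumZ (T : choiceType) (I : set T) (c : \bar R) (f : T -> \bar R) : 0 <= c ->
  (forall i, 0 <= f i) ->
  \esum_(i in I) (c * f i) = c * \esum_(i in I) f i.
Proof.
have le (d : R) (h : T -> \bar R) : (0 < d)%R -> (forall i, 0 <= h i) ->
    \esum_(i in I) (d%:E * h i) <= d%:E * \esum_(i in I) h i.
  move=> d0 h0; apply: ge_ereal_sup => _ [A [finA AI] <-].
  rewrite -ge0_mule_fsumr//; apply: lee_wpmul2l; first by rewrite lee_fin ltW.
  by apply: esum_ge; exists A.
move=> + f0; case: c => [c| _ |//]; last first.
  have [[i [Ii fi]]|nof] := pselect (exists i, I i /\ 0 < f i).
    have single (h : T -> \bar R) : (forall i, 0 <= h i) -> h i <= \esum_(j in I) h j.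
      move=> h0; apply: esum_ge; exists [set i]; last by rewrite fsbig_set1.
      by split; [exact: finite_set1|move=> _ ->].
    rewrite gt0_mulye; last by apply: lt_le_trans (single f f0).
    apply/eqP; rewrite -leye_eq.
    have := single (fun j => +oo * f j); rewrite gt0_mulye//; apply=> j.
    by rewrite mule_ge0// leey.
  have f00 i : I i -> f i = 0.
    move=> Ii; apply/eqP; rewrite eq_le f0 andbT leNgt; apply/negP => fi.
    by apply: nof; exists i.
  by rewrite (esum1 f00) mule0 esum1// => i /f00 ->; rewrite mule0.
rewrite lee_fin le_eqVlt => /orP[/eqP <-|c0].
  by rewrite mul0e esum1// => i _; rewrite mul0e.
apply/eqP; rewrite eq_le le//=.
rewrite -[leRHS]mul1e -(mulfV (lt0r_neq0 c0)) EFinM -muleA.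
apply: lee_wpmul2l; first by rewrite lee_fin ltW.
have [c0' e] : (0 < c^-1)%R /\ (forall i, f i = c^-1%:E * (c%:E * f i)).
  by split=> [|i]; rewrite ?invr_gt0// muleA -EFinM mulVf ?mul1e// lt0r_neq0.
rewrite (eq_esum (fun i _ => e i)); apply: le => // i.
by rewrite mule_ge0// lee_fin ltW.
Qed.

Lemma esum_exchange (T T' : choiceType) (F : T -> T' -> \bar R) :
  (forall i j, 0 <= F i j) ->
  \esum_(i in [set: T]) \esum_(j in [set: T']) F i j =
  \esum_(j in [set: T']) \esum_(i in [set: T]) F i j.
Proof.
move=> F0; rewrite (esum_esum (J := fun=> setT))// (esum_esum (J := fun=> setT))//.
rewrite (reindex_esum ([set: T'] `*`` (fun=> [set: T])) _ (fun x => (x.2, x.1)))//.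
split=> // [[x y] [x' y'] _ _ [-> ->]//|[x y] _].
by exists (y, x).
Qed.

Lemma esum_pred1 (T : choiceType) (t : T) (f : T -> \bar R) : 0 <= f t ->
  \esum_(i in [set: T]) ((i == t)%:R%:E * f i) = f t.
Proof.
move=> f0; rewrite -[RHS](esum_set1 f0) esum_mkcond [RHS]esum_mkcond.
apply: eq_esum => i _; rewrite in_setT in_set1.
by case: eqP => _; rewrite ?mul1e ?mul0e.
Qed.

End esum_extra.

Section expectation.
Context {R : realType} {G : groupType}.
Implicit Types (mu : G -> R).
Local Open Scope ereal_scope.

Definition wsum mu (f : G -> \bar R) : \bar R :=
  \esum_(g in [set: G]) ((mu g)%:E * f g).

Lemma wsum_ge0 mu f : (forall g, 0 <= mu g)%R -> (forall g, 0 <= f g) -> 0 <= wsum mu f.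
Proof. by move=> m0 f0; apply: esum_ge0 => g _; rewrite mule_ge0// lee_fin. Qed.

Lemma le_wsum mu f h : (forall g, 0 <= mu g)%R -> (forall g, f g <= h g) ->
  wsum mu f <= wsum mu h.
Proof. by move=> m0 fh; apply: le_esum => g _; apply: lee_wpmul2l => //; rewrite lee_fin. Qed.

Lemma eq_wsum mu f h : f =1 h -> wsum mu f = wsum mu h.
Proof. by move=> fh; apply: eq_esum => g _; rewrite fh. Qed.

Lemma wsumD mu f h : (forall g, 0 <= mu g)%R -> (forall g, 0 <= f g) ->
  (forall g, 0 <= h g) -> wsum mu (fun g => f g + h g) = wsum mu f + wsum mu h.
Proof.
move=> m0 f0 h0; rewrite /wsum -esumD.
- by apply: eq_esum => g _; rewrite ge0_muleDr.
- by move=> g _; rewrite mule_ge0// lee_fin.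
- by move=> g _; rewrite mule_ge0// lee_fin.
Qed.

Lemma wsumZ mu c f : (forall g, 0 <= mu g)%R -> (forall g, 0 <= f g) -> 0 <= c ->
  wsum mu (fun g => c * f g) = c * wsum mu f.
Proof.
move=> m0 f0 c0; rewrite /wsum -esumZ//.
  by apply: eq_esum => g _; rewrite muleCA.
by move=> g; rewrite mule_ge0// lee_fin.
Qed.

Lemma wsum_cst mu c : (forall g, 0 <= mu g)%R -> 0 <= c ->
  wsum mu (fun=> c) = c * wsum mu (fun=> 1).
Proof.
move=> m0 c0; rewrite -wsumZ//.
by apply: eq_wsum => g; rewrite mule1.
Qed.

Lemma wsum_exchange mu mu' (F : G -> G -> \bar R) : (forall g, 0 <= mu g)%R ->
  (forall g, 0 <= mu' g)%R -> (forall g h, 0 <= F g h) ->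
  wsum mu (fun g => wsum mu' (F g)) = wsum mu' (fun h => wsum mu (F ^~ h)).
Proof.
move=> m0 m0' F0; rewrite /wsum.
under eq_esum => g _ do
  (rewrite -esumZ ?lee_fin//; last by move=> h; rewrite mule_ge0// lee_fin).
under [RHS]eq_esum => h _ do
  (rewrite -esumZ ?lee_fin//; last by move=> g; rewrite mule_ge0// lee_fin).
rewrite esum_exchange; last by move=> g h; rewrite !mule_ge0// lee_fin.
by apply: eq_esum => h _; apply: eq_esum => g _; rewrite muleCA.
Qed.

(** Expectation over words of [n] independent increments, as an iterated sum: independence of past
    and future is then the concatenation rule [Ex_cat], without any probability space. *)
Fixpoint Ex mu (n : nat) (f : seq G -> \bar R) : \bar R :=
  if n is m.+1 then wsum mu (fun g => Ex mu m (fun s => f (g :: s))) else f [::].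

Lemma eq_Ex mu n f h : f =1 h -> Ex mu n f = Ex mu n h.
Proof.
elim: n f h => [|n IH] f h fh /=; first exact: fh.
by apply: eq_wsum => g; apply: IH => s; exact: fh.
Qed.

Lemma Ex_cat mu m n f :
  Ex mu (m + n) f = Ex mu m (fun s => Ex mu n (fun t => f (s ++ t))).
Proof.
elim: m f => [//|m IH] f /=; apply: eq_wsum => g; exact: IH.
Qed.

Section Ex_theory.
Variable mu : G -> R.
Hypothesis mu0 : forall g, (0 <= mu g)%R.

Lemma Ex_ge0 n f : (forall s, 0 <= f s) -> 0 <= Ex mu n f.
Proof.
by elim: n f => [|n IH] f f0 //=; apply: wsum_ge0 => // g; apply: IH.
Qed.

Lemma le_Ex n f h : (forall s, size s = n -> f s <= h s) -> Ex mu n f <= Ex mu n h.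
Proof.
elim: n f h => [|n IH] f h fh /=; first exact: fh.
by apply: le_wsum => // g; apply: IH => s sn; apply: fh; rewrite /= sn.
Qed.

Lemma ExD n f h : (forall s, 0 <= f s) -> (forall s, 0 <= h s) ->
  Ex mu n (fun s => f s + h s) = Ex mu n f + Ex mu n h.
Proof.
elim: n f h => [//|n IH] f h f0 h0 /=.
rewrite -wsumD//; first by apply: eq_wsum => g; rewrite IH.
- by move=> g; exact: Ex_ge0.
- by move=> g; exact: Ex_ge0.
Qed.

Lemma ExZ n c f : (forall s, 0 <= f s) -> 0 <= c ->
  Ex mu n (fun s => c * f s) = c * Ex mu n f.
Proof.
elim: n f => [//|n IH] f f0 c0 /=.
rewrite -wsumZ//; first by apply: eq_wsum => g; rewrite IH.
by move=> g; exact: Ex_ge0.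
Qed.

Lemma Ex_sum n (I : Type) (r : seq I) (F : I -> seq G -> \bar R) :
  (forall i s, 0 <= F i s) ->
  Ex mu n (fun s => \sum_(i <- r) F i s) = \sum_(i <- r) Ex mu n (F i).
Proof.
move=> F0; elim: r => [|i r IH].
  rewrite big_nil; under eq_Ex do rewrite big_nil -(mul0e 0).
  by rewrite ExZ// mul0e.
rewrite big_cons -IH -ExD//; first by apply: eq_Ex => s; rewrite big_cons.
by move=> s; exact: sume_ge0.
Qed.

Lemma Ex_wsum mu' n (F : seq G -> G -> \bar R) : (forall g, 0 <= mu' g)%R ->
  (forall s g, 0 <= F s g) ->
  Ex mu n (fun s => wsum mu' (F s)) = wsum mu' (fun g => Ex mu n (F ^~ g)).
Proof.
move=> m0'; elim: n F => [//|n IH] F F0 /=.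
rewrite -wsum_exchange//; last by move=> g h; exact: Ex_ge0.
by apply: eq_wsum => g; rewrite IH.
Qed.

Lemma Ex_cst n c : wsum mu (fun=> 1) = 1 -> 0 <= c ->
  Ex mu n (fun=> c) = c.
Proof.
by move=> m1 c0; elim: n => [//|n /= ->]; rewrite wsum_cst// m1 mule1.
Qed.

(** The perturbation estimate: each increment costs one factor [c]. *)
Lemma le_Ex_measure mu' c n f : (forall g, mu' g <= c * mu g)%R ->
  (forall g, 0 <= mu' g)%R -> (0 <= c)%R -> (forall s, 0 <= f s) ->
  Ex mu' n f <= (c ^+ n)%:E * Ex mu n f.
Proof.
move=> mm m0' c0; elim: n f => [|n IH] f f0 /=; first by rewrite expr0 mul1e.
have E0 g : 0 <= Ex mu n (fun s => f (g :: s)) by exact: Ex_ge0.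
apply: (@le_trans _ _ (wsum mu' (fun g => (c ^+ n)%:E * Ex mu n (fun s => f (g :: s))))).
  by apply: le_wsum => // g; exact: IH.
rewrite wsumZ//; last by rewrite lee_fin exprn_ge0.
rewrite exprSr EFinM -muleA; apply: lee_wpmul2l; first by rewrite lee_fin exprn_ge0.
rewrite /wsum -esumZ ?lee_fin//; last by move=> g; rewrite mule_ge0// lee_fin.
apply: le_esum => g _; rewrite muleA; apply: lee_wpmul2r => //.
by rewrite -EFinM lee_fin.
Qed.

End Ex_theory.

Section law.
Variable mu : G -> R.
Hypothesis mu0 : forall g, (0 <= mu g)%R.
Hypothesis mu1 : wsum mu (fun=> 1) = 1.

Definition gprod (s : seq G) : G := (\prod_(g <- s) g)%g.

Lemma gprod_cons g s : gprod (g :: s) = (g * gprod s)%g.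
Proof. by rewrite /gprod big_cons. Qed.

Lemma gprod_cat s t : gprod (s ++ t) = (gprod s * gprod t)%g.
Proof. by rewrite /gprod big_cat. Qed.

(** The [N]-fold convolution power of [mu]. Passing to it turns the Schottky words, all of length
    [N], into single increments. *)
Definition step_law N (g : G) : R := fine (Ex mu N (fun s => (gprod s == g)%:R%:E)).

Lemma step_lawE N g : (step_law N g)%:E = Ex mu N (fun s => (gprod s == g)%:R%:E).
Proof.
rewrite /step_law fineK// ge0_fin_numE ?Ex_ge0//.
apply: (@le_lt_trans _ _ 1); last exact: ltry.
rewrite -(Ex_cst mu0 N mu1 lee01); apply: le_Ex => // s _.
by rewrite lee_fin; case: eqP.
Qed.

Lemma step_law_ge0 N g : (0 <= step_law N g)%R.
Proof. by rewrite -lee_fin step_lawE; apply: Ex_ge0. Qed.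

Lemma wsum_step_law N f : (forall g, 0 <= f g) ->
  wsum (step_law N) f = Ex mu N (fun s => f (gprod s)).
Proof.
move=> f0; transitivity
    (wsum (fun=> 1%R) (fun g => Ex mu N (fun s => (gprod s == g)%:R%:E * f g))).
  apply: eq_esum => g _; rewrite mul1e step_lawE muleC -ExZ//.
  by apply: eq_Ex => s; rewrite muleC.
rewrite -Ex_wsum//; last by move=> s g; rewrite mule_ge0// lee_fin.
apply: eq_Ex => s; rewrite /wsum -[RHS]esum_pred1//.
by apply: eq_esum => g _; rewrite mul1e eq_sym.
Qed.

Lemma step_law1 N : wsum (step_law N) (fun=> 1) = 1.
Proof. by rewrite wsum_step_law// Ex_cst. Qed.

Lemma Ex_step_law N n f : (forall g, 0 <= f g) ->
  Ex (step_law N) n (fun s => f (gprod s)) = Ex mu (n * N) (fun s => f (gprod s)).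
Proof.
elim: n f => [//|n IH] f f0 /=.
rewrite mulSn Ex_cat.
transitivity (wsum (step_law N) (fun g => Ex mu (n * N) (fun t => f (g * gprod t)%g))).
  apply: eq_wsum => g; rewrite -(IH (fun h => f (g * h)%g))//.
  by apply: eq_Ex => s; rewrite gprod_cons.
rewrite wsum_step_law//; last by move=> g; apply: Ex_ge0.
by apply: eq_Ex => s; apply: eq_Ex => t; rewrite gprod_cat.
Qed.

End law.
End expectation.

(** * Exponential spreading of the walk *)

Section kernel_bounded.
Context {R : realType} {G : groupType} {X : metricType R}.
Variables (act : G -> X -> X) (al : R) (p : G -> R) (q : nat) (s : 'I_q -> G) (eps : R).
Hypothesis isom : isometric_action act.
Hypothesis al0 : 0 < al.
Hypothesis p0 : forall g, 0 <= p g.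
Hypothesis p1 : wsum p (fun=> 1%E) = 1%E.
Hypothesis eps0 : 0 <= eps.
Hypothesis eps_le : forall g, eps * \sum_i (g == s i)%:R <= p g.
Hypothesis sweep_le : forall l : seq X,
  kern al (sweep (fun i => act (s i)) l) (sweep (fun i => act (s i)) l)
    <= (q%:R / 2) ^+ 2 * kern al l l.

(** The dual of the kernel form: [u] acts on finite lists of points, with norm at most [c] relative
    to the square root of the form. *)
Definition kernel_bounded (c : R) (u : X -> \bar R) :=
  (forall x, (0 <= u x)%E) /\
  forall l : seq X, (\sum_(x <- l) u x <= (c * Num.sqrt (kern al l l))%:E)%E.

Let rest g := p g - eps * \sum_i (g == s i)%:R.

Let rest0 g : 0 <= rest g. Proof. by rewrite subr_ge0. Qed.

Let wsum_rest (f : G -> \bar R) : (forall g, 0 <= f g)%E ->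
  (wsum p f = wsum rest f + eps%:E * \sum_i f (s i))%E.
Proof.
move=> f0.
have -> : (\sum_i f (s i) = wsum (fun g => \sum_i (g == s i)%:R)%R f)%E.
  rewrite /wsum; under eq_bigr do rewrite -esum_pred1//.
  rewrite -esum_sum; last by move=> g i _ _; rewrite mule_ge0// lee_fin.
  by apply: eq_esum => g _; rewrite -sumEFin ge0_sume_distrl.
rewrite /wsum -esumZ ?lee_fin//; last first.
  by move=> g; rewrite mule_ge0// lee_fin sumr_ge0.
rewrite -esumD; last 2 first.
- by move=> g _; rewrite mule_ge0// lee_fin.
- by move=> g _; rewrite !mule_ge0// lee_fin// sumr_ge0.
apply: eq_esum => g _; rewrite muleA -EFinM -ge0_muleDl//.
- by rewrite -EFinD subrK.
- by rewrite lee_fin.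
- by rewrite lee_fin mulr_ge0// sumr_ge0.
Qed.

Let wsum_rest1 : wsum rest (fun=> 1%E) = (1 - eps * q%:R)%:E.
Proof.
have := wsum_rest (fun _ => lee01); rewrite p1.
under eq_bigr do rewrite -[1%E]/(1%:E).
rewrite sumEFin sumr_const card_ord.
have := wsum_ge0 rest0 (fun _ => lee01).
case: (wsum rest _) => [r| |] //=.
by rewrite lee_fin => r0 [/eqP]; rewrite -subr_eq => /eqP <-.
Qed.

(** Split [p] into [rest], of mass [1 - eps q], which preserves the bound by invariance under
    isometries, and the Schottky part, where [sweep_le] replaces [q] by [q / 2]. The total is
    [1 - eps q / 2]. *)
Lemma kernel_bounded_step c u : 0 <= c -> kernel_bounded c u ->
  kernel_bounded (c * (1 - eps * q%:R / 2)) (fun x => wsum p (fun g => u (act g x))).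
Proof.
move=> c0 [u0 uc]; split=> [x|l]; first exact: wsum_ge0.
set F := Num.sqrt (kern al l l); have F0 : 0 <= F by exact: sqrtr_ge0.
have -> : (\sum_(x <- l) wsum p (fun g => u (act g x)) =
    wsum p (fun g => \sum_(x <- l) u (act g x)))%E.
  rewrite /wsum -esum_sum; last by move=> g x _ _; rewrite mule_ge0// lee_fin.
  by apply: eq_esum => g _; rewrite ge0_sume_distrr.
have s0 g : (0 <= \sum_(x <- l) u (act g x))%E by exact: sume_ge0.
rewrite wsum_rest//.
apply: (@le_trans _ _ ((c * F * (1 - eps * q%:R))%:E + (eps * (c * (q%:R / 2 * F)))%:E)%E);
  last by rewrite -EFinD lee_fin; lra.
apply: leeD.
  rewrite [leRHS]EFinM -wsum_rest1 -wsum_cst ?lee_fin ?mulr_ge0//.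
  apply: le_wsum => // g; have := uc [seq act g x | x <- l].
  by rewrite big_map kern_map_isometry// => x y; exact: mdist_act.
rewrite [leRHS]EFinM; apply: lee_wpmul2l; first by rewrite lee_fin.
have := uc (sweep (fun i => act (s i)) l).
rewrite /sweep big_flatten big_map big_enum/= -/(sweep _ _).
under eq_bigr do rewrite big_map.
move/le_trans; apply; rewrite lee_fin ler_wpM2l//.
have q2 : 0 <= q%:R / 2 :> R by rewrite divr_ge0.
rewrite -(ger0_norm q2) -sqrtr_sqr -sqrtrM ?sqr_ge0//.
by rewrite ler_wsqrtr//; exact: sweep_le.
Qed.

Lemma kernel_bounded_iter n u : eps * q%:R <= 1 -> kernel_bounded 1 u ->
  kernel_bounded ((1 - eps * q%:R / 2) ^+ n)
    (fun x => Ex p n (fun w => u (act (gprod w) x))).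
Proof.
move=> eps1 u1; elim: n => [|n IH].
  rewrite expr0 /=; under [fun x => _]funext do rewrite /gprod big_nil (act_one isom).
  exact: u1.
have [u0 _] := u1.
have e0 : 0 <= eps * q%:R by rewrite mulr_ge0.
have := kernel_bounded_step _ IH.
rewrite -exprSr exprn_ge0; last by lra.
move=> /(_ isT); congr kernel_bounded; apply: funext => x.
(* The last increment of a word acts first on [x], so the induction peels off the end of the
   word. *)
rewrite -[in RHS]addn1 Ex_cat/= -Ex_wsum//.
by apply: eq_Ex => t; apply: eq_wsum => g; rewrite gprod_cat /gprod big_seq1 (act_mulg isom).
Qed.

Lemma kernel_bounded_expR z : kernel_bounded 1 (fun x => (expR (- (al * mdist x z)))%:E).
Proof.
split=> [x|l]; first by rewrite lee_fin expR_ge0.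
rewrite sumEFin lee_fin mul1r -[leLHS]ger0_norm; last first.
  by rewrite sumr_ge0// => x _; exact: expR_ge0.
by rewrite -sqrtr_sqr ler_wsqrtr// sqr_sum_expR_le_kern.
Qed.

Lemma Ex_expR_mdist_le n (o z : X) : eps * q%:R <= 1 ->
  (Ex p n (fun w => (expR (- (al * mdist (act (gprod w) o) z)))%:E)
    <= ((1 - eps * q%:R / 2) ^+ n)%:E)%E.
Proof.
move=> eps1; have [_ /(_ [:: o])] := kernel_bounded_iter n eps1 (kernel_bounded_expR z).
rewrite big_seq1 /kern !big_seq1 mdistxx mulr0 oppr0 expR0 sqrtr1 mulr1.
exact.
Qed.

End kernel_bounded.

(** * Uniformly positive drift *)

Section chain.
Context {R : realType} {X : metricType R}.
Variable delta : R.
Hypothesis hyp : forall o : X, hyperbolic_at delta o.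

(** Dyadic halving: each of the [k] levels loses one [delta], so [2 ^ k] steps lose only a
    logarithmic amount. *)
Lemma gromov_product_chain (z : nat -> X) (v : X) (t : R) (k i : nat) :
  (forall j, (i <= j < i + 2 ^ k)%N -> t <= gromov_product v (z j) (z j.+1)) ->
  t - k%:R * delta <= gromov_product v (z i) (z (i + 2 ^ k)%N).
Proof.
elim: k i => [|k IH] i H.
  by rewrite mul0r subr0 expn0 addn1; apply: H; rewrite expn0 addn1 leqnn ltnSn.
have e : (2 ^ k.+1 = 2 ^ k + 2 ^ k)%N by rewrite expnS mul2n addnn.
rewrite -natr1 mulrDl mul1r opprD addrA e addnA.
apply: (hyperbolic_atP (y := z (i + 2 ^ k)%N) (hyp v)).
  by apply: IH => j /andP[ij jk]; apply: H; rewrite ij e; lia.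
by apply: IH => j /andP[ij jk]; apply: H; rewrite e; lia.
Qed.

(** At [v] on the geodesic the product of [o] and [y] vanishes, so one of the products of the
    endpoint with [y] and with [o] is at most [delta]. The first gives the lower bound on the
    distance to [y]; the second forces, by the chain lemma, a step with small Gromov product at [v].
    The point [v] is chosen before the path, so that estimates at a fixed point apply to it. *)
Lemma pass_near_or_far (geod : geodesic X) (o y : X) (r : R) (k : nat) : 0 <= delta -> 0 <= r ->
  exists v : X, forall z : nat -> X, z 0%N = o ->
    mdist (z (2 ^ k)%N) v - r - 2 * delta <= mdist (z (2 ^ k)%N) y - mdist y o \/
    mdist v o = r /\ exists2 i : nat, (i < 2 ^ k)%N &
      mdist (z i) v - mdist (z i) (z i.+1) <= k.+1%:R * delta + 1.
Proof.
move=> d0 r0; have [yr|ry] := leP (mdist y o) r.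
  (* When [y] is within [r] of [o], the first alternative holds trivially with [v = y]. *)
  by exists y => z z0; left; lra.
have [gam [g0 g1 gi]] := geod o y; rewrite metric_sym in g1 gi.
have vo : mdist (gam r) o = r.
  rewrite -{1}g0 gi ?lexx ?r0 ?(ltW ry) ?(le_trans r0 (ltW ry))//.
  by rewrite subr0 ger0_norm.
have vy : mdist y (gam r) = mdist y o - r.
  rewrite -{1}g1 gi ?lexx ?r0 ?(ltW ry) ?(le_trans r0 (ltW ry))//.
  by rewrite ger0_norm// subr_ge0 ltW.
exists (gam r) => z z0.
have := hyp (gam r) o (z (2 ^ k)%N) y.
have -> : gromov_product (gam r) o y = 0.
  by rewrite /gromov_product vy (metric_sym o (gam r)) vo (metric_sym o y); lra.
rewrite lerBlDr add0r ge_min => /orP[near|far]; last first.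
  by left; move: far; rewrite /gromov_product vy; lra.
right; split=> //; apply: contrapT => none.
have : k.+1%:R * delta + 1 - k%:R * delta <= gromov_product (gam r) (z 0%N) (z (0 + 2 ^ k)%N).
  apply: gromov_product_chain => j /andP[_ jk].
  have [//|short] := leP (k.+1%:R * delta + 1) (gromov_product (gam r) (z j) (z j.+1)).
  exfalso; apply: none; exists j => //.
  have := gromov_product_ge_subr (gam r) (z j) (z j.+1).
  by rewrite (metric_sym (gam r)); lra.
by rewrite z0 add0n -natr1; lra.
Qed.

End chain.

Section drift.
Context {R : realType} {G : groupType} {X : metricType R}.
Variables (act : G -> X -> X) (o : X) (delta al L kp : R) (p : G -> R).
Hypothesis isom : isometric_action act.
Hypothesis geod : geodesic X.
Hypothesis delta0 : 0 <= delta.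
Hypothesis hyp : forall o : X, hyperbolic_at delta o.
Hypothesis al0 : 0 < al.
Hypothesis L0 : 0 <= L.
Hypothesis kp0 : 0 < kp.
Hypothesis p0 : forall g, 0 <= p g.
Hypothesis p1 : wsum p (fun=> 1%E) = 1%E.
Hypothesis moment :
  (wsum p (fun g => (expR (al * mdist (act g o) o))%:E) <= (expR L)%:E)%E.
Hypothesis spread : forall n (v : X),
  (Ex p n (fun w => (expR (- (al * mdist (act (gprod w) o) v)))%:E) <= (expR (- (kp * n%:R)))%:E)%E.

Let Z w := act (gprod w) o.

Let e0 x : (0 <= (expR x)%:E :> \bar R)%E. Proof. by rewrite lee_fin expR_ge0. Qed.

Let Zcons g w : mdist (Z (g :: w)) o <= mdist (act g o) o + mdist (Z w) o.
Proof.
rewrite /Z gprod_cons (act_mulg isom).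
apply: le_trans (metric_triangle _ (act g o) _) _.
by rewrite mdist_act// addrC.
Qed.

Lemma Ex_moment n :
  (Ex p n (fun w => (expR (al * mdist (Z w) o))%:E) <= (expR (L * n%:R))%:E)%E.
Proof.
elim: n => [|n IH] /=.
  by rewrite /Z /gprod big_nil (act_one isom) mdistxx !mulr0.
apply: (@le_trans _ _ (wsum p (fun g =>
    (expR (L * n%:R))%:E * (expR (al * mdist (act g o) o))%:E)%E)).
  apply: le_wsum => // g; rewrite muleC.
  apply: le_trans (lee_wpmul2l _ IH); last by rewrite lee_fin expR_ge0.
  rewrite -ExZ//; try by move=> *; exact: e0.
  by apply: le_Ex => // w _; rewrite -EFinM lee_fin -expRD -mulrDr ler_expR ler_pM2l ?Zcons.
rewrite wsumZ//; try by move=> *; exact: e0.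
apply: le_trans (lee_wpmul2l _ moment) _; first exact: e0.
by rewrite -EFinM lee_fin -expRD -natr1 mulrDr mulr1.
Qed.

(** For small [n] the exponential moment keeps the walk away from [v]; for large [n] the spreading
    does. The denominator [t.+1] balances the two regimes and makes the bound independent of [n]. *)
Lemma Ex_far n (v : X) (t : nat) : L <= kp * t%:R ->
  (Ex p n (fun w => (expR (- (al * mdist (Z w) v)))%:E)
    <= (expR (- (al * mdist v o / t.+1%:R)))%:E)%E.
Proof.
move=> Lt.
have far : (Ex p n (fun w => (expR (- (al * mdist (Z w) v)))%:E)
    <= (expR (- (al * mdist v o)) * expR (L * n%:R))%:E)%E.
  rewrite EFinM; apply: le_trans (lee_wpmul2l _ (Ex_moment n)).
    rewrite -ExZ//; try by move=> *; exact: e0.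
    apply: le_Ex => // w _; rewrite -EFinM lee_fin -expRD ler_expR.
    have := metric_triangle v (Z w) o; rewrite (metric_sym v (Z w)).
    by rewrite -(ler_pM2l al0); lra.
  by rewrite lee_fin expR_ge0.
have t1 : 0 < t.+1%:R :> R by rewrite ltr0n.
set m := mdist v o in far *.
have [near|near] := leP (al * m / t.+1%:R) (kp * n%:R).
  by apply: le_trans (spread n v) _; rewrite lee_fin ler_expR lerN2.
apply: le_trans far _; rewrite lee_fin -expRD ler_expR.
set u := al * m / t.+1%:R in near *.
have mE : al * m = u * t%:R + u.
  by rewrite /u -{1}(divfK (lt0r_neq0 t1) (al * m)) -natr1 mulrDr mulr1.
have h1 : L * n%:R <= kp * n%:R * t%:R by rewrite mulrAC ler_wpM2r.
have h2 : kp * n%:R * t%:R <= u * t%:R by rewrite ler_wpM2r// ltW.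
by rewrite mE; lra.
Qed.

(** The jump after time [i] is independent of the position at time [i]: it costs one moment [exp L],
    later increments integrate to [1], and [Ex_far] handles the position. *)
Lemma Ex_jump n (v : X) (c : R) (t i : nat) : L <= kp * t%:R -> (i < n)%N ->
  (Ex p n (fun w => (expR (al * (c - mdist (Z (take i w)) v
      + mdist (Z (take i w)) (Z (take i.+1 w)))))%:E)
    <= (expR (al * c + L - al * mdist v o / t.+1%:R))%:E)%E.
Proof.
move=> Lt lin.
have -> : n = (i + (n - i.+1).+1)%N by lia.
set m := (n - i.+1)%N.
rewrite Ex_cat.
apply: (@le_trans _ _ (Ex p i (fun s =>
    (expR (al * c + L))%:E * (expR (- (al * mdist (Z s) v)))%:E)%E)).
  apply: le_Ex => // s si /=.
  apply: (@le_trans _ _ (wsum p (fun g =>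
      (expR (al * c - al * mdist (Z s) v))%:E * (expR (al * mdist (act g o) o))%:E)%E)).
    apply: le_wsum => // g; rewrite -EFinM -[leRHS](Ex_cst p0 m p1);
      last by rewrite lee_fin mulr_ge0 ?expR_ge0.
    apply: le_Ex => // w _; rewrite lee_fin -expRD ler_expR.
    rewrite take_size_cat// take_cat si ltnNge leqnSn/= subSnn/= take0.
    rewrite {3}/Z gprod_cat gprod_cons /gprod big_nil mulg1 (act_mulg isom) -/(gprod s).
    rewrite {2}/Z mdist_act// (metric_sym o); lra.
  rewrite wsumZ//; try by move=> *; exact: e0.
  apply: le_trans (lee_wpmul2l _ moment) _; first exact: e0.
  by rewrite -!EFinM lee_fin -!expRD ler_expR; lra.
rewrite ExZ//; try by move=> *; exact: e0.
apply: le_trans (lee_wpmul2l _ (Ex_far i v Lt)) _; first exact: e0.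
by rewrite -EFinM lee_fin -expRD.
Qed.

(** The four terms: [d(Z_n o, y) - d(y, o)] is at least [2 r - 2 delta]; otherwise the end point is
    near [v], or some step passes near [v], both multiplied by the largest value [exp(lam M n)] of
    the integrand when [d(Z_n o, o) <= M n]; lastly [d(Z_n o, o)] exceeds [M n]. *)
Let bound (lam M r : R) (k t : nat) :=
  expR (- (lam * (2 * r - 2 * delta)))
  + expR (lam * M * (2 ^ k)%:R) *
     (expR (3 * al * r - kp * (2 ^ k)%:R)
     + (2 ^ k)%:R * expR (al * (k.+1%:R * delta + 1) + L - al * r / t.+1%:R))
  + expR (L * (2 ^ k)%:R - (al - lam) * M * (2 ^ k)%:R).

Let Ex_bound lam M r k t y : 0 <= lam <= al -> 0 <= r -> L <= kp * t%:R ->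
  (Ex p (2 ^ k) (fun w => (expR (- (lam * (mdist (Z w) y - mdist y o))))%:E)
    <= (bound lam M r k t)%:E)%E.
Proof.
move=> /andP[lam0 lamal] r0 Lt; set n := (2 ^ k)%N.
have [v vP] := pass_near_or_far hyp geod o y k delta0 r0.
pose c := k.+1%:R * delta + 1.
pose A w := expR (al * (3 * r - mdist (Z w) v)).
(* The indicator confines these terms to the case [d(v, o) = r], the only one where [Ex_jump] yields
   decay in [r]. *)
pose B i w := (mdist v o == r)%:R * expR (al * (c - mdist (Z (take i w)) v
      + mdist (Z (take i w)) (Z (take i.+1 w)))).
pose D w := expR (- ((al - lam) * M * n%:R)) * expR (al * mdist (Z w) o).
have A0 w : 0 <= A w by exact: expR_ge0.
have B0 i w : 0 <= B i w by rewrite mulr_ge0 ?expR_ge0.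
have D0 w : 0 <= D w by rewrite mulr_ge0 ?expR_ge0.
have S0 w : 0 <= \sum_(i < n) B i w by rewrite sumr_ge0.
have pt w : size w = n -> expR (- (lam * (mdist (Z w) y - mdist y o))) <=
   expR (- (lam * (2 * r - 2 * delta))) +
   expR (lam * M * n%:R) * (A w + \sum_(i < n) B i w) + D w.
  move=> sw; set T := mdist (Z w) y - mdist y o.
  have g0 : 0 <= expR (- (lam * (2 * r - 2 * delta))) by exact: expR_ge0.
  have f0 : 0 <= expR (lam * M * n%:R) * (A w + \sum_(i < n) B i w).
    by rewrite mulr_ge0 ?expR_ge0 ?addr_ge0.
  have [good|bad] := leP (2 * r - 2 * delta) T.
    have : expR (- (lam * T)) <= expR (- (lam * (2 * r - 2 * delta))).
      by rewrite ler_expR lerN2 ler_wpM2l.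
    by have := D0 w; lra.
  have TD : - T <= mdist (Z w) o.
    by have := metric_triangle y (Z w) o; rewrite (metric_sym y (Z w)) /T; lra.
  have lT : - (lam * T) <= lam * mdist (Z w) o by rewrite -mulrN ler_wpM2l.
  have [short|long] := leP (mdist (Z w) o) (M * n%:R); last first.
    have : expR (- (lam * T)) <= D w.
      rewrite /D -expRD ler_expR; apply: le_trans lT _.
      have : (al - lam) * (M * n%:R) <= (al - lam) * mdist (Z w) o.
        by rewrite ler_wpM2l ?subr_ge0// ltW.
      lra.
    lra.
  have e1 : expR (- (lam * T)) <= expR (lam * M * n%:R).
    by rewrite ler_expR (le_trans lT)// -mulrA ler_wpM2l.
  suff one : 1 <= A w + \sum_(i < n) B i w.
    have : expR (lam * M * n%:R) * 1 <= expR (lam * M * n%:R) * (A w + \sum_(i < n) B i w).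
      by rewrite ler_wpM2l ?expR_ge0.
    by have := D0 w; rewrite mulr1; lra.
  have := vP (fun i => Z (take i w)); rewrite take0 /= {1}/Z /gprod big_nil (act_one isom).
  rewrite -/n take_oversize ?sw// => /(_ erefl)[near|[vr [i iN ic]]].
    have : 1 <= A w.
      rewrite /A -[leLHS]expR0 ler_expR mulr_ge0 ?(ltW al0)//.
      by move: bad near; rewrite /T; lra.
    by have := S0 w; lra.
  have : B i w <= \sum_(i < n) B i w.
    apply: (ler_sum_mem (F := fun i : 'I_n => B i w) _ (y := Ordinal iN)) => //.
    by rewrite mem_index_enum.
  have : 1 <= B i w.
    rewrite /B vr eqxx mul1r -[leLHS]expR0 ler_expR mulr_ge0 ?(ltW al0)//.
    by move: ic; rewrite /c; lra.
  by have := A0 w; lra.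
apply: le_trans (le_Ex p0 (h := fun w => ((expR (- (lam * (2 * r - 2 * delta))))%:E +
   (expR (lam * M * n%:R))%:E * ((A w)%:E + \sum_(i < n) (B i w)%:E) + (D w)%:E)%E) _) _.
  by move=> w sw; have := pt w sw; rewrite -lee_fin !EFinD EFinM EFinD -sumEFin.
have AB0 w : (0 <= (A w)%:E + \sum_(i < n) (B i w)%:E)%E.
  by rewrite sumEFin -EFinD lee_fin addr_ge0.
rewrite ExD//; last by move=> w; rewrite adde_ge0// mule_ge0.
rewrite ExD//; last by move=> w; rewrite mule_ge0.
rewrite Ex_cst// ExZ// ExD//; last by move=> w; rewrite sumEFin lee_fin.
rewrite /bound -/n; rewrite !EFinD; apply: leeD; first apply: leeD => //.
- rewrite EFinM; apply: lee_wpmul2l => //.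
  rewrite EFinD; apply: leeD.
    rewrite /A; under eq_Ex do rewrite mulrBr expRD EFinM.
    rewrite ExZ//; apply: le_trans (lee_wpmul2l _ (spread n v)) _ => //.
    by rewrite -EFinM -expRD lee_fin ler_expR; lra.
  rewrite Ex_sum//; last by move=> i w; rewrite lee_fin.
  rewrite -[in leRHS](card_ord n) -sum1_card natr_sum mulr_suml -sumEFin.
  apply: lee_sum => i _; rewrite mul1r /B.
  have [vr|vr] := eqVneq (mdist v o) r.
    under eq_Ex do rewrite mul1r.
    by have := Ex_jump v c Lt (ltn_ord i); rewrite vr.
  by under eq_Ex do rewrite mul0r; rewrite Ex_cst.
- rewrite /D; under eq_Ex do rewrite EFinM.
  rewrite ExZ//; apply: le_trans (lee_wpmul2l _ (Ex_moment n)) _ => //.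
  by rewrite -EFinM -expRD lee_fin ler_expR; lra.
Qed.

Lemma exists_contracting_time : exists2 n : nat, (0 < n)%N &
  exists2 lam : R, 0 < lam <= al & forall y : X,
  (Ex p n (fun w => (expR (- (lam * (mdist (Z w) y - mdist y o))))%:E) <= (2^-1)%:E)%E.
Proof.
have d0 := delta0; have a0 := al0; have l0 := L0; have k0 := kp0.
pose t := (Num.truncn (L / kp)).+1.
have Lt : L <= kp * t%:R.
  by rewrite -ler_pdivrMl// mulrC ltW// truncnS_gt.
have t1 : 0 < t.+1%:R :> R by rewrite ltr0n.
(* With [r = eps n], the cost [3 al r] of being near [v] is half of the spreading exponent
   [kp n]. *)
pose eps := kp / (6 * al).
have eps0 : 0 < eps by rewrite divr_gt0// mulr_gt0.
have eE : al * eps = kp / 6 by rewrite /eps; field; rewrite gt_eqF.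
pose c := al * eps / t.+1%:R.
have c0 : 0 < c by rewrite divr_gt0// mulr_gt0.
have cE : c <= kp / 2.
  rewrite /c ler_pdivrMr// eE.
  have : kp * 1 <= kp * t.+1%:R by rewrite ler_wpM2l ?(ltW k0)// ler1n.
  lra.
(* As [lam <= al / 2], this gives [(al - lam) M >= L + 1], which beats the moment growth [L] by
   [1]. *)
pose M := 2 * (L + 1) / al.
have M0 : 0 < M by rewrite divr_gt0// mulr_gt0//; lra.
have ME : al * M = 2 * (L + 1) by rewrite /M; field; rewrite gt_eqF.
(* The second bound keeps the prefactor [exp(lam M n)] below [exp(c n / 2)], half of the rate gained
   for the jumps. *)
pose lam := Num.min (al / 2) (c / (2 * M)).
have lam0 : 0 < lam by rewrite lt_min !divr_gt0// mulr_gt0.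
have lam_al : lam <= al / 2 by rewrite ge_min lexx.
have lamM : lam * M <= c / 2.
  rewrite -ler_pdivlMr// -mulrA -invfM ge_min lexx orbT//.
(* The worst of the four exponential rates. [C0] collects the constants and [C1] the terms linear in
   [k]: the loss along the chain and the number [2 ^ k <= exp k] of possible jumps. *)
pose c' := Num.min (2 * lam * eps) (Num.min (c / 2) 1).
have c'0 : 0 < c'.
  by rewrite !lt_min ltr01 andbT; apply/andP; split; [rewrite mulr_gt0// mulr_gt0|rewrite divr_gt0].
have c'1 : c' <= 2 * lam * eps by rewrite ge_min lexx.
have c'2 : c' <= c / 2 by rewrite !ge_min lexx orbT.
have c'3 : c' <= 1 by rewrite !ge_min lexx !orbT.
pose C0 := 2 * lam * delta + al * delta + al + L + 7.
pose C1 := 1 + al * delta.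
have [k kP] := affine_lt_expn2 (C0 / c') (C1 / c').
exists (2 ^ k)%N; first by rewrite expn_gt0.
exists lam => [|y]; first by rewrite lam0 (le_trans lam_al)// ler_pdivrMr// ler_pMr// ler1n.
set N : R := (2 ^ k)%:R in kP.
have N0 : 0 <= N by rewrite /N.
have big : C0 + C1 * k%:R <= c' * N.
  have : c' * (C0 / c' + C1 / c' * k%:R) <= c' * N by rewrite ler_wpM2l// ltW.
  by congr (_ <= _); field; rewrite gt_eqF.
have kr : 0 <= k%:R :> R by [].
have adk : 0 <= al * delta * k%:R by rewrite !mulr_ge0// ltW.
have ad : 0 <= al * delta by rewrite mulr_ge0// ltW.
have ld : 0 <= lam * delta by rewrite mulr_ge0// ltW.
have Nk : N <= expR k%:R.
  rewrite /N natrX -[k%:R]mulr1 expRM_natl lerXn2r ?nnegrE ?expR_ge0//.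
  by have := expR_ge1Dx (1 : R); lra.
(* Since [exp 7 >= 1 + 7]; four terms of [1/8] make the required [1/2]. *)
have small (x : R) : x <= - 7 -> expR x <= 8^-1.
  move=> x7; apply: (@le_trans _ _ (expR (- 7))); first by rewrite ler_expR.
  rewrite expRN lef_pV2 ?posrE ?expR_gt0//.
  by have := expR_ge1Dx (7 : R); lra.
have lam01 : 0 <= lam <= al by rewrite (ltW lam0)/=; lra.
have r0 : 0 <= eps * N by rewrite mulr_ge0// ltW.
apply: le_trans (@Ex_bound lam M (eps * N) k t y lam01 r0 Lt) _.
rewrite lee_fin /bound -/N.
have cN1 : c' * N <= 2 * lam * eps * N by rewrite ler_wpM2r.
have cN2 : c' * N <= c / 2 * N by rewrite ler_wpM2r.
have cN3 : c' * N <= N by rewrite ler_piMl.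
have cN4 : c * N <= kp / 2 * N by rewrite ler_wpM2r.
have lMN : lam * M * N <= c / 2 * N by rewrite ler_wpM2r.
have eN : 3 * al * (eps * N) = kp / 2 * N.
  by rewrite -mulrA (mulrA al) eE; field.
have cN : al * (eps * N) / t.+1%:R = c * N by rewrite /c; field; rewrite gt_eqF.
have C1E : C1 * k%:R = k%:R + al * delta * k%:R by rewrite /C1 mulrDl mul1r.
rewrite C1E /C0 in big.
have T1 : expR (- (lam * (2 * (eps * N) - 2 * delta))) <= 8^-1.
  by apply: small; lra.
have T2 : expR (lam * M * N) * expR (3 * al * (eps * N) - kp * N) <= 8^-1.
  by rewrite -expRD; apply: small; rewrite eN; lra.
have T3 : expR (lam * M * N) * (N * expR (al * (k.+1%:R * delta + 1) + L
    - al * (eps * N) / t.+1%:R)) <= 8^-1.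
  rewrite cN mulrCA -expRD.
  apply: (@le_trans _ _ (expR k%:R *
      expR (lam * M * N + (al * (k.+1%:R * delta + 1) + L - c * N)))).
    by rewrite ler_wpM2r ?expR_ge0.
  have e1 : al * (k.+1%:R * delta + 1) = al * delta * k%:R + al * delta + al.
    by rewrite -natr1; ring.
  by rewrite -expRD; apply: small; rewrite e1; lra.
have T4 : expR (L * N - (al - lam) * M * N) <= 8^-1.
  apply: small.
  have h : (L + 1) * N <= (al - lam) * M * N.
    rewrite ler_wpM2r//.
    have : al / 2 * M <= (al - lam) * M by rewrite ler_wpM2r ?(ltW M0)//; lra.
    by rewrite mulrAC ME; lra.
  lra.
rewrite [expR (lam * M * N) * _]mulrDr; lra.
Qed.

End drift.

(** * From the support of the measure to a contracting time *)

Section support_words.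
Context {R : realType} {G : groupType}.
Variable mu : G -> R.
Hypothesis mu0 : forall g, 0 <= mu g.
Hypothesis mu1 : wsum mu (fun=> 1%E) = 1%E.

Definition support_word (n : nat) (g : G) :=
  exists s : seq G, [/\ size s = n, (forall x, x \in s -> 0 < mu x) & gprod s = g].

Lemma support_wordM m n g h :
  support_word m g -> support_word n h -> support_word (m + n) (g * h)%g.
Proof.
move=> [s [sm sp <-]] [t [tn tp <-]]; exists (s ++ t); split.
- by rewrite size_cat sm tn.
- by move=> x; rewrite mem_cat => /orP[/sp|/tp].
- exact: gprod_cat.
Qed.

Lemma support_wordX m n g : support_word m g -> support_word (n * m) (g ^+ n)%g.
Proof.
move=> gm; elim: n => [|n IH]; last by rewrite mulSn expgS; exact: support_wordM.
by exists [::]; split=> //; rewrite /gprod big_nil.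
Qed.

Lemma generated_semigroup_support_word g :
  generated_semigroup (msupport mu) g -> exists2 n, (0 < n)%N & support_word n g.
Proof.
move=> /(_ [set g | exists2 n, (0 < n)%N & support_word n g]); apply; split.
  move=> x y [m m0 xm] [n n0 yn]; exists (m + n)%N; first by rewrite addn_gt0 m0.
  exact: support_wordM.
move=> x x0; exists 1%N => //; exists [:: x]; split=> //.
  by move=> y; rewrite inE => /eqP ->.
by rewrite /gprod big_seq1.
Qed.

Lemma step_law_gt0 n g : support_word n g -> 0 < step_law mu n g.
Proof.
move=> [s [sn sp <-]].
apply: (@lt_le_trans _ _ (\prod_(x <- s) mu x)).
  rewrite big_seq; elim/big_ind : _ => //; first by move=> x y; exact: mulr_gt0.
rewrite -lee_fin step_lawE// -sn {sn sp}; elim: s => [|x s IH].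
  by rewrite big_nil /= eqxx.
rewrite big_cons EFinM /= /wsum.
apply: esum_ge.
exists [set x]; first by split=> //; exact: finite_set1.
rewrite fsbig_set1; apply: lee_wpmul2l; first by rewrite lee_fin.
apply: le_trans IH _; apply: le_Ex => // t _; rewrite lee_fin !gprod_cons.
by rewrite (inj_eq (mulgI _)).
Qed.

End support_words.

Lemma exists_common_lower_bound (R : realType) (q : nat) (f : 'I_q -> R) :
  (forall i, 0 < f i) -> exists2 m : R, 0 < m <= 1 & forall i, m <= f i.
Proof.
move=> f0; pose s := 1 + \sum_i (f i)^-1.
have s1 : 1 <= s by rewrite lerDl sumr_ge0// => i _; rewrite invr_ge0 ltW.
have s0 : 0 < s by exact: lt_le_trans s1.
exists s^-1; first by rewrite invr_gt0 s0 invf_le1.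
move=> i; rewrite -[f i]invrK lef_pV2 ?posrE ?invr_gt0//.
apply: (@le_trans _ _ (\sum_i (f i)^-1)); last by rewrite lerDr.
apply: (ler_sum_mem (F := fun i => (f i)^-1)); last by rewrite mem_index_enum.
by move=> z; rewrite invr_ge0 ltW.
Qed.

Section word_metric_bound.
Context {R : realType} {G : groupType} {X : metricType R}.
Variables (act : G -> X -> X) (o : X) (S : seq G).
Hypothesis isom : isometric_action act.
Hypothesis gen : generates S.

Lemma mdist_le_word_metric : exists2 Lip : R, 0 < Lip &
  forall g, mdist (act g o) o <= Lip * word_metric R S 1%g g.
Proof.
(* The [1] keeps the constant positive even if the generators fix [o]. *)
pose Lip : R := 1 + \sum_(x <- S) mdist (act x o) o.
have S0 : 0 <= \sum_(x <- S) mdist (act x o) o by rewrite sumr_ge0// => x _; exact: mdist_ge0.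
have Lip0 : 0 < Lip by rewrite ltr_wpDr.
exists Lip => // g.
have letter_le x : (x \in S) || (x^-1%g \in S) -> mdist (act x o) o <= Lip.
  have inS y : y \in S -> mdist (act y o) o <= Lip.
    move=> yS; apply: (@le_trans _ _ (\sum_(x <- S) mdist (act x o) o)); last by rewrite lerDr.
    by apply: (ler_sum_mem (F := fun x => mdist (act x o) o)) => // z; exact: mdist_ge0.
  by move=> /orP[/inS//|/inS]; rewrite mdist_act_inv.
have word_le s : word_in S s -> mdist (act (gprod s) o) o <= Lip * (size s)%:R.
  elim: s => [_|x s IH /= /andP[xS /IH sS]].
    by rewrite /gprod big_nil (act_one isom) mdistxx mulr0.
  rewrite gprod_cons (act_mulg isom) -natr1 mulrDr mulr1.
  apply: le_trans (metric_triangle _ (act x o) _) _.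
  by rewrite mdist_act// lerD// letter_le.
rewrite -ler_pdivrMl//; apply: lb_le_inf.
  have [s sS ->] := gen g.
  by exists (size s)%:R; exists s => //=; rewrite invg1 mul1g.
move=> _ [s [sS /= ] + <-]; rewrite invg1 mul1g => sg.
by rewrite ler_pdivrMl// -sg word_le.
Qed.

End word_metric_bound.

Section contracting_time.
Context {R : realType} {G : groupType} {X : metricType R}.
Variables (S : seq G) (act : G -> X -> X) (o : X) (mu : G -> R).
Hypothesis generatesS : generates S.
Hypothesis geod : geodesic X.
Hypothesis hyperbolicX : gromov_hyperbolic X.
Hypothesis isom : isometric_action act.
Hypothesis acyl : acylindrical act.
Hypothesis mu0 : forall g, 0 <= mu g.
Hypothesis mu1 : wsum mu (fun=> 1%E) = 1%E.
Hypothesis tail : exponential_tail S mu.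
Hypothesis nonel : non_elementary act (generated_semigroup (msupport mu)).

Lemma exponential_moment : exists al L : R, [/\ 0 < al, 0 <= L &
  (wsum mu (fun g => (expR (al * mdist (act g o) o))%:E) <= (expR L)%:E)%E].
Proof.
have [alpha alpha0 fin] := tail.
have [Lip Lip0 LipP] := mdist_le_word_metric o isom generatesS.
exists (alpha / Lip).
set I := (\esum_(g in _) _)%E in fin.
have I0 : (0 <= I)%E.
  by apply: esum_ge0 => g _; rewrite lee_fin mulr_ge0 ?expR_ge0.
(* The moment [I] is at most [exp I]. *)
exists (fine I); split; [exact: divr_gt0|exact: fine_ge0|].
apply: (@le_trans _ _ I).
  apply: le_esum => g _; rewrite -EFinM lee_fin mulrC ler_wpM2r// ler_expR.
  by rewrite -mulrA ler_wpM2l ?(ltW alpha0)// ler_pdivrMl.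
rewrite -(fineK (_ : I \is a fin_num)) ?ge0_fin_numE// lee_fin.
by have := expR_ge1Dx (fine I); lra.
Qed.

Lemma contracting_time : exists al L : R, [/\ 0 < al, 0 <= L,
  (wsum mu (fun g => (expR (al * mdist (act g o) o))%:E) <= (expR L)%:E)%E &
  exists2 n : nat, (0 < n)%N & exists2 lam : R, 0 < lam <= al & forall y : X,
  (Ex mu n (fun w => (expR (- (lam * (mdist (act (gprod w) o) y - mdist y o))))%:E)
     <= (2^-1)%:E)%E].
Proof.
have [al [L [al0 L0 momL]]] := exponential_moment.
exists al, L; split=> //.
have [delta delta0 hyp'] := hyperbolicX.
have hyp (z : X) : hyperbolic_at delta z by move=> x y w; exact: hyp'.
have [a [b [aS bS alox _ free]]] := nonel.
have [la la0 aw] := generated_semigroup_support_word aS.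
have [lb lb0 bw] := generated_semigroup_support_word bS.
pose B := kern_const al delta.
have B0 : 0 <= B by exact: expR_ge0.
(* Makes [q (1 + 3 B) <= q^2 / 8]; the other eighth, [3 q^2 ep] with [ep <= 1/24], comes from the
   choice of [k]. Together they give [(q / 2)^2]. *)
pose q := (Num.truncn (8 * (1 + 3 * B))).+1.
have qB : 8 * (1 + 3 * B) <= q%:R by rewrite ltW// truncnS_gt.
have [l [tau sch]] := schottky_family o isom acyl delta0 hyp alox free q.
pose t := tau + delta + 1.
(* The first entry is needed for ping-pong; the second gives [ep <= exp(- 23) <= 1/24]. *)
pose k := Num.max (2 * t + delta) (4 * t + 2 * delta + 23 / al).
have [m [sfar vfar kfar]] := sch k.
pose s (i : 'I_q) := (b ^+ i * (a ^+ l) ^+ m * b ^+ (q - i))%g.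
(* Common length of all the [s i] as words in the support, so that a single convolution power
   charges each of them. *)
pose N := (q * lb + m * (l * la))%N.
have N0 : (0 < N)%N by rewrite addn_gt0 muln_gt0 lb0.
have sN i : support_word mu N (s i).
  have -> : N = (i * lb + m * (l * la) + (q - i) * lb)%N.
    by rewrite addnAC -mulnDl subnKC// ltnW.
  apply: support_wordM; last exact: support_wordX.
  by apply: support_wordM; [exact: support_wordX|do 2 apply: support_wordX].
pose p := step_law mu N.
have p0 g : 0 <= p g by exact: step_law_ge0.
have p1 : wsum p (fun=> 1%E) = 1%E by exact: step_law1.
have [m' /andP[m'0 m'1] m'P] := exists_common_lower_bound (fun i => step_law_gt0 mu0 mu1 (sN i)).
have q0 : 0 < q%:R :> R by [].
(* Division by [q] allows for coincidences: an element equal to several [s i] still receives at most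
   [m']. *)
pose eps := m' / q%:R.
have epsq : eps * q%:R = m' by rewrite divfK// gt_eqF.
have eps0 : 0 <= eps by rewrite divr_ge0// ltW.
have eps_le g : eps * \sum_i (g == s i)%:R <= p g.
  have [[i gi]|no] := pselect (exists i, g = s i); last first.
    by rewrite big1 ?mulr0// => i _; case: eqP => // gi; case: no; exists i.
  apply: (@le_trans _ _ (eps * q%:R)); last by rewrite epsq gi; exact: m'P.
  rewrite ler_wpM2l// -[q in leRHS]card_ord -sum1_card natr_sum.
  by apply: ler_sum => j _; case: eqP.
have sweep_le (ls : seq X) : kern al (sweep (fun i => act (s i)) ls) (sweep (fun i => act (s i)) ls)
    <= (q%:R / 2) ^+ 2 * kern al ls ls.
  have tk : 2 * (tau + delta + 1) + delta <= k by rewrite le_max lexx.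
  have act_pre i : act (s i) (act (s i)^-1%g o) = o.
    by rewrite -(act_mulg isom) mulgV (act_one isom).
  have sisom i x y : mdist (act (s i) x) (act (s i) y) = mdist x y by exact: mdist_act.
  apply: le_trans (@kern_sweep _ _ al delta tau k o q
    (fun i => act (s i)) (fun i => act (s i)^-1%g o) al0 delta0 (hyp o)
    sisom act_pre sfar vfar kfar tk ls _) _ => //.
  rewrite ler_wpM2r ?kern_ge0// -/B -/t.
  set ep := expR _.
  have ep24 : ep <= 24^-1.
    have k2 : 4 * t + 2 * delta + 23 / al <= k by rewrite le_max lexx orbT.
    have : al * (23 / al) <= al * (k - (4 * t + 2 * delta)).
      by rewrite ler_wpM2l ?(ltW al0)//; lra.
    rewrite mulrCA mulfV ?gt_eqF// mulr1 => h.
    rewrite /ep expRN lef_pV2 ?posrE ?expR_gt0//.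
    by have := expR_ge1Dx (al * (k - (4 * t + 2 * delta))); lra.
  have h1 : q%:R * (8 * (1 + 3 * B)) <= q%:R * q%:R by rewrite ler_wpM2l// ltW.
  have h2 : (q%:R * q%:R) * ep <= (q%:R * q%:R) * 24^-1 by rewrite ler_wpM2l// mulr_ge0.
  by rewrite exprMn !expr2; lra.
pose kp := - ln (1 - m' / 2).
have m2 : 0 < 1 - m' / 2 by lra.
have kp0 : 0 < kp by rewrite oppr_gt0 ln_lt0//; lra.
have spread n (v : X) : (Ex p n (fun w => (expR (- (al * mdist (act (gprod w) o) v)))%:E)
    <= (expR (- (kp * n%:R)))%:E)%E.
  have eps1 : eps * q%:R <= 1 by rewrite epsq.
  apply: le_trans (Ex_expR_mdist_le isom al0 p0 p1 eps0 eps_le sweep_le n o v eps1) _.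
  by rewrite epsq /kp mulNr opprK expRM_natr lnK.
have momp : (wsum p (fun g => (expR (al * mdist (act g o) o))%:E) <= (expR (L * N%:R))%:E)%E.
  rewrite wsum_step_law//.
  exact: (Ex_moment isom al0 mu0 momL).
have LN0 : 0 <= L * N%:R by rewrite mulr_ge0.
have [n n0 [lam lam0 lamP]] :=
  exists_contracting_time isom geod delta0 hyp al0 LN0 kp0 p0 p1 momp spread.
exists (n * N)%N; first by rewrite muln_gt0 n0.
exists lam => // y; apply: le_trans (lamP y).
by rewrite (Ex_step_law mu0 mu1 N n (f := fun g =>
  (expR (- (lam * (mdist (act g o) y - mdist y o))))%:E)).
Qed.

End contracting_time.

(** * The law of the walk *)

Lemma generates_countable (G : groupType) (S : seq G) :
  generates S -> countable [set: G].
Proof.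
move=> gen; pose T := S ++ [seq x^-1%g | x <- S].
pose f (l : seq nat) := gprod [seq nth 1%g T i | i <- l].
suff -> : [set: G] = f @` [set: seq nat].
  by apply: (card_le_trans (card_image_le _ _)); exact: countableP.
apply/seteqP; split=> // g _; have [s sS ->] := gen g.
exists [seq index x T | x <- s] => //; rewrite /f -map_comp; congr gprod.
elim: s sS => //= x s IH /andP[xS /IH ->]; rewrite nth_index//.
rewrite mem_cat; case/orP: xS => [->//|xS]; apply/orP; right.
by apply/mapP; exists x^-1%g; rewrite ?invgK.
Qed.

Section esum_words.
Context {R : realType} {G : groupType}.
Variable mu : G -> R.
Hypothesis mu0 : forall g, 0 <= mu g.

Definition word_weight (n : nat) (s : seq G) : R :=
  if size s == n then \prod_(x <- s) mu x else 0.

Lemma word_weight_ge0 n s : 0 <= word_weight n s.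
Proof. by rewrite /word_weight; case: ifP => // _; apply: prodr_ge0. Qed.

Lemma esum_word_weight n (f : seq G -> \bar R) : (forall s, 0 <= f s)%E ->
  (\esum_(s in [set: seq G]) ((word_weight n s)%:E * f s) = Ex mu n f)%E.
Proof.
elim: n f => [|n IH] f f0.
  rewrite -[RHS](esum_pred1 (f0 [::])); apply: eq_esum => s _.
  by rewrite /word_weight size_eq0; case: eqP => [->|]//; rewrite big_nil.
pose c (x : G * seq G) := x.1 :: x.2.
have cinj : set_inj [set: G * seq G] c by move=> [g s] [h t] _ _ [-> ->].
transitivity (\esum_(s in c @` [set: G * seq G]) ((word_weight n.+1 s)%:E * f s))%E.
  rewrite [RHS]esum_mkcond; apply: eq_esum => -[|g s] _.
    by rewrite /word_weight /= mul0e; case: ifP.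
  by rewrite mem_set//; exists (g, s).
rewrite esum_image// /= /wsum.
under [RHS]eq_esum => g _ do
  (rewrite -IH// -esumZ ?lee_fin//;
   last by move=> s; rewrite mule_ge0// lee_fin word_weight_ge0).
rewrite (esum_esum (J := fun=> setT))//; last first.
  by move=> *; rewrite !mule_ge0// lee_fin// word_weight_ge0.
rewrite (_ : [set: G] `*`` _ = [set: G * seq G]); last by apply/seteqP; split.
apply: eq_esum => -[g s] _ /=; rewrite muleA -EFinM; congr (_%:E * _)%E.
by rewrite /word_weight /= eqSS; case: ifP; rewrite ?mulr0// big_cons.
Qed.

End esum_words.

Section walk_law.
Context {R : realType} {G : groupType} {d : measure_display} {Omega : measurableType d}.
Variables (S : seq G) (P : probability Omega R) (mu : G -> R) (X : nat -> Omega -> G).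
Hypothesis gen : generates S.
Hypothesis mu0 : forall g, 0 <= mu g.
Hypothesis iidX : iid P mu X.

Let Y n w := mkseq (fun i => X i w) n.
Let level n t := [set w | Y n w = t].

Let levelE n t : level n t = if size t == n then
  \bigcap_(i in [set` iota 0 n]) (X i @^-1` [set nth 1%g t i]) else set0.
Proof.
case: eqP => [tn|tn]; apply/seteqP; split=> w //=.
- move=> Yt i /=; rewrite mem_iota add0n => /andP[_ lin].
  by rewrite -Yt nth_mkseq.
- move=> Xt; apply: (@eq_from_nth _ 1%g); rewrite size_mkseq// => i lin.
  by rewrite nth_mkseq// Xt//= mem_iota add0n.
- by move=> Yt; apply: tn; rewrite -Yt size_mkseq.
Qed.

Let measurable_level n t : measurable (level n t).
Proof.
rewrite levelE; case: ifP => // _; apply: fin_bigcap_measurable => //.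
by move=> i _; exact: (iid_measurable iidX).
Qed.

Let P_level n t : P (level n t) = (word_weight mu n t)%:E.
Proof.
rewrite levelE /word_weight; case: eqP => [tn|_]; last by rewrite measure0.
rewrite (iid_indep iidX (fun i => [set nth 1%g t i]) (iota_uniq 0 n)).
rewrite (eq_bigr (fun i => (mu (nth 1%g t i))%:E)) => [|i _]; last exact: (iid_law iidX).
rewrite prodEFin -tn; congr _%:E.
by rewrite [RHS](big_nth 1%g) /index_iota subn0.
Qed.

Let countable_words : countable [set: seq G].
Proof.
have /countable_injP[f finj] := generates_countable gen.
have finj' : injective f by move=> x y; apply: finj; rewrite inE.
apply/countable_injP; exists (pickle \o map f) => s t _ _ /= /(pcan_inj pickleK).
exact: inj_map.
Qed.

Lemma measurable_words n (A : set (seq G)) :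
  measurable [set w | A (mkseq (fun i => X i w) n)].
Proof.
rewrite -/(Y n); have -> : [set w | A (Y n w)] =
    \bigcup_(t : seq G) (if t \in A then level n t else set0).
  apply/seteqP; split=> [w Aw|w [t _]].
    by exists (Y n w) => //; rewrite mem_set.
  by case: ifP => // /set_mem At /= ->.
apply: countable_bigcupT_measurable countable_words _ => t.
by case: ifP => _; [exact: measurable_level|exact: measurable0].
Qed.

(** Countability of the words splits the space into the level sets of the first [n] increments,
    where the integrand is constant and independence gives the mass. *)
Lemma integral_words n (f : seq G -> \bar R) : (forall s, 0 <= f s)%E ->
  (\int[P]_w f (mkseq (fun i => X i w) n) = Ex mu n f)%E.
Proof.
move=> f0; have /countable_injP[code cinj] := countable_words.
pose F k := [set w | code (Y n w) = k].
have FT : \bigcup_k F k = [set: Omega].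
  by apply/seteqP; split=> // w _; exists (code (Y n w)).
rewrite -FT ge0_integral_bigcup//; last 3 first.
- by move=> k; exact: (measurable_words n [set t | code t = k]).
- rewrite FT => _ B mB; rewrite setTI.
  exact: (measurable_words n [set t | B (f t)]).
- apply/trivIsetP => i j _ _ ij; apply/seteqP; split=> // w [wi wj].
  by move: ij; rewrite -[i]wi -[j]wj eqxx.
rewrite nneseries_esumT; last by move=> k; apply: integral_ge0 => w _.
transitivity (\esum_(k in code @` [set: seq G]) \int[P]_(w in F k) f (Y n w))%E.
  rewrite [RHS]esum_mkcond; apply: eq_esum => k _; case: ifPn => // /negP kn.
  rewrite (_ : F k = set0) ?integral_set0//; apply/seteqP; split=> // w /= wk.
  by apply: kn; rewrite mem_set//; exists (Y n w).
rewrite esum_image; last by move=> s t; exact: cinj.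
rewrite -esum_word_weight//; apply: eq_esum => t _.
have -> : F (code t) = level n t.
  apply/seteqP; split=> w /=; last by move=> wt; congr code; exact: wt.
  by apply: cinj; rewrite inE.
rewrite muleC -P_level -integral_cst//; apply: eq_integral => w.
by rewrite inE => wt; congr f; exact: wt.
Qed.

End walk_law.

(** * Conclusion *)

Lemma fekete (R : realType) (a : nat -> R) : (forall n, 0 <= a n) ->
  (forall m n, a (m + n)%N <= a m + a n) ->
  exists l : R, n%:R^-1 * a n @[n --> \oo] --> l.
Proof.
move=> a0 aD.
have aM k m r : a (k * m + r)%N <= k%:R * a m + a r.
  elim: k => [|k IH]; first by rewrite mul0n add0n mul0r add0r.
  rewrite mulSn -addnA; apply: le_trans (aD _ _) _.
  by rewrite -natr1 mulrDl mul1r; lra.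
pose E := [set x : R | exists2 m : nat, (0 < m)%N & x = m%:R^-1 * a m].
have E0 x : E x -> 0 <= x by move=> [m m0 ->]; rewrite mulr_ge0// invr_ge0.
have infE : has_inf E by split; [exists (1%:R^-1 * a 1%N), 1%N|exists 0].
exists (inf E); apply/cvgrPdist_lt => e e0.
have [_ [m m0 ->] me] := inf_adherent (divr_gt0 e0 (ltr0Sn R 1)) infE.
pose A := \sum_(r < m) a r.
have A0 : 0 <= A by rewrite sumr_ge0.
near=> n.
have n0 : (0 < n)%N by near: n; exact: nbhs_infty_gt.
have n0' : 0 < n%:R :> R by rewrite ltr0n.
have m0' : 0 < m%:R :> R by rewrite ltr0n.
have nA : A < e / 2 * n%:R.
  rewrite -ltr_pdivrMl ?divr_gt0//.
  near: n; exact: nbhs_infty_gtr.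
have le_inf : inf E <= n%:R^-1 * a n.
  by apply: ge_inf; [exists 0|exists n].
rewrite distrC ger0_norm ?subr_ge0// ltrBlDr -ltr_pdivlMl ?invr_gt0// invrK.
rewrite {1}(divn_eq n m); apply: le_lt_trans (aM _ _ _) _.
have ar : a (n %% m)%N <= A.
  apply: (ler_sum_mem (F := fun r : 'I_m => a r) _ (y := Ordinal (ltn_pmod n m0))) => //.
  by rewrite mem_index_enum.
have qm : (n %/ m)%:R * a m <= n%:R * (m%:R^-1 * a m).
  rewrite mulrA ler_wpM2r// ler_pdivlMr// -natrM ler_nat.
  exact: leq_trunc_div.
have : n%:R * (m%:R^-1 * a m) < n%:R * (inf E + e / 2) by rewrite ltr_pM2l.
by rewrite mulrDr (mulrC (e / 2)) in nA *; lra.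
Unshelve. all: by end_near. Qed.

(** * Measures near the given one *)

Section neighborhood.
Context {R : realType} {G : groupType}.
Variables (mu mu0 : G -> R).

Lemma is_probability_wsum (nu : G -> R) : is_probability nu ->
  (forall g, 0 <= nu g) /\ wsum nu (fun=> 1%E) = 1%E.
Proof.
by move=> [nu0 nu1]; split=> //; rewrite -[RHS]nu1; apply: eq_esum => g _; rewrite mule1.
Qed.

Lemma ndist_le (K : R) : is_probability mu -> is_probability mu0 ->
  (ndist mu mu0 <= K%:E)%E -> forall g, mu g <= (1 + K) * mu0 g.
Proof.
move=> [m0 _] [m00 _]; rewrite /ndist; case: asboolP => [supp|_]; last by rewrite leye_eq.
rewrite leeBlDr// -EFinD => supK g.
have [g0|] := ltP 0 (mu0 g); last first.
  move=> g0; have mg : mu0 g = 0 by apply/eqP; rewrite eq_le g0 m00.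
  have : ~ msupport mu g by rewrite supp /msupport /= mg ltxx.
  by rewrite mg mulr0 /msupport /= leNgt => /negP.
have : ((Num.max (mu g / mu0 g) (mu0 g / mu g))%:E <= (K + 1)%:E)%E.
  by apply: le_trans supK; apply: ereal_sup_ubound; exists g.
rewrite lee_fin ge_max => /andP[+ _].
by rewrite ler_pdivrMr// addrC.
Qed.

End neighborhood.

Section walk_bounds.
Context {R : realType} {G : groupType} {X : metricType R}.
Variables (act : G -> X -> X) (o : X) (mu : G -> R) (al L lam : R) (n0 : nat).
Hypothesis isom : isometric_action act.
Hypothesis mu0 : forall g, 0 <= mu g.
Hypothesis mu1 : wsum mu (fun=> 1%E) = 1%E.
Hypothesis L0 : 0 <= L.
Hypothesis lam0 : 0 < lam.
Hypothesis lam_al : lam <= al.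
Hypothesis n00 : (0 < n0)%N.
Hypothesis moment :
  (wsum mu (fun g => (expR (al * mdist (act g o) o))%:E) <= (expR L)%:E)%E.

Let D w := mdist (act (gprod w) o) o.
Let f y w := expR (- (lam * (mdist (act (gprod w) o) y - mdist y o))).

Hypothesis contract : forall y : X, (Ex mu n0 (fun w => (f y w)%:E) <= (2 / 3)%:E)%E.

Let al0 : 0 < al. Proof. exact: lt_le_trans lam_al. Qed.

Let f0 y w : (0 <= (f y w)%:E)%E. Proof. by rewrite lee_fin expR_ge0. Qed.

(** Cocycle relation: after the word [s], the target [y] seen from the walk is its translate by the
    inverse of [s]. Bounds uniform in [y] therefore multiply. *)
Let f_cat y s t : f y (s ++ t) = f y s * f (act (gprod s)^-1%g y) t.
Proof.
rewrite /f -expRD gprod_cat (act_mulg isom); congr expR.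
have e x : mdist x (act (gprod s)^-1%g y) = mdist (act (gprod s) x) y.
  by rewrite -(mdist_act isom (gprod s)) -(act_mulg isom) mulgV (act_one isom).
by rewrite [mdist (act _^-1%g y) o]metric_sym !e; ring.
Qed.

Let Ex_cocycle m n (A B : R) : 0 <= B ->
  (forall y, Ex mu m (fun w => (f y w)%:E) <= A%:E)%E ->
  (forall y, Ex mu n (fun w => (f y w)%:E) <= B%:E)%E ->
  forall y, (Ex mu (m + n) (fun w => (f y w)%:E) <= (A * B)%:E)%E.
Proof.
move=> B0 mA nB y; rewrite Ex_cat.
apply: (@le_trans _ _ (Ex mu m (fun s => B%:E * (f y s)%:E)%E)).
  apply: le_Ex => // s _; under eq_Ex do rewrite f_cat EFinM.
  rewrite ExZ//.
  by rewrite [leRHS]muleC; apply: lee_wpmul2l => //; exact: f0.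
rewrite ExZ//.
by rewrite mulrC EFinM; apply: lee_wpmul2l; rewrite ?lee_fin.
Qed.

(** [L n0] bounds the cost of the remainder of [n] modulo [n0]; [1/3] absorbs the rounding of
    [n / n0], each full block contributing [2/3 <= exp(- 1/3)]. *)
Definition walk_const : R := expR (L * n0%:R + 1 / 3).

Lemma Ex_walk_le n y :
  (Ex mu n (fun w => (f y w)%:E) <= (walk_const * expR (- (n%:R / (3 * n0%:R))))%:E)%E.
Proof.
have pow k z : (Ex mu (k * n0) (fun w => (f z w)%:E) <= ((2 / 3) ^+ k)%:E)%E.
  elim: k z => [|k IH] z.
    by rewrite mul0n expr0 /= /f /gprod big_nil (act_one isom) metric_sym subrr mulr0 oppr0 expR0.
  by rewrite mulSn exprS; apply: Ex_cocycle => //; rewrite exprn_ge0.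
have rem r z : (r <= n0)%N -> (Ex mu r (fun w => (f z w)%:E) <= (expR (L * n0%:R))%:E)%E.
  move=> rn; apply: (@le_trans _ _ (expR (L * r%:R))%:E); last first.
    by rewrite lee_fin ler_expR ler_wpM2l// ler_nat.
  apply: le_trans (Ex_moment isom al0 mu0 moment r); apply: le_Ex => // w _.
  rewrite lee_fin ler_expR.
  have := metric_triangle z (act (gprod w) o) o; rewrite (metric_sym z (act _ o)) => tri.
  apply: (@le_trans _ _ (lam * mdist (act (gprod w) o) o)).
    by rewrite -mulrN ler_wpM2l ?(ltW lam0)//; lra.
  by rewrite ler_wpM2r// mdist_ge0.
have n0r : 0 < n0%:R :> R by rewrite ltr0n.
rewrite {1}(divn_eq n n0).
apply: le_trans (Ex_cocycle _ (pow _) (rem _ ^~ _) y) _.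
- exact: expR_ge0.
- by rewrite ltnW// ltn_pmod.
rewrite lee_fin /walk_const.
have e23 : (2 / 3 : R) <= expR (- (1 / 3)).
  by have := expR_ge1Dx (- (1 / 3) : R); lra.
have : (2 / 3 : R) ^+ (n %/ n0) <= expR (- (1 / 3)) ^+ (n %/ n0).
  by apply: lerXn2r; rewrite ?nnegrE ?expR_ge0.
rewrite -expRM_natl => h.
apply: le_trans (ler_wpM2r (expR_ge0 _) h) _.
rewrite -!expRD ler_expR.
have : n%:R / n0%:R <= (n %/ n0)%:R + 1 :> R.
  by rewrite ler_pdivrMr// natr1 -natrM ler_nat ltnW// ltn_ceil.
have -> : n%:R / (3 * n0%:R) = (n%:R / n0%:R) / 3 :> R by rewrite invfM mulrCA mulrC.
lra.
Qed.

Lemma Ex_dist_fin n : (Ex mu n (fun w => (D w)%:E) \is a fin_num)%E.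
Proof.
rewrite ge0_fin_numE; last by apply: Ex_ge0 => // w; rewrite lee_fin mdist_ge0.
apply: (@le_lt_trans _ _ ((al^-1)%:E * (expR (L * n%:R))%:E)%E); last by rewrite -EFinM ltry.
apply: le_trans (lee_wpmul2l _ (Ex_moment isom al0 mu0 moment n)).
  rewrite -ExZ; [|exact: mu0|by move=> w; rewrite lee_fin expR_ge0|by rewrite lee_fin invr_ge0 ltW].
  apply: le_Ex => // w _; rewrite -EFinM lee_fin ler_pdivlMl//.
  by apply: le_trans (expR_ge1Dx _); rewrite lerDr.
by rewrite lee_fin invr_ge0 ltW.
Qed.

Let a n := fine (Ex mu n (fun w => (D w)%:E)).

Let aE n : (a n)%:E = Ex mu n (fun w => (D w)%:E). Proof. by rewrite fineK// Ex_dist_fin. Qed.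

Let a0 n : 0 <= a n.
Proof. by rewrite -lee_fin aE; apply: Ex_ge0 => // w; rewrite lee_fin mdist_ge0. Qed.

Let aD m n : a (m + n)%N <= a m + a n.
Proof.
rewrite -lee_fin EFinD !aE Ex_cat.
have D0 w : (0 <= (D w)%:E)%E by rewrite lee_fin mdist_ge0.
apply: (@le_trans _ _ (Ex mu m (fun s => (D s)%:E + Ex mu n (fun t => (D t)%:E))%E)).
  apply: le_Ex => // s _.
  rewrite -[X in (_ <= X + _)%E](Ex_cst mu0 n mu1) ?D0// -ExD//.
  apply: le_Ex => // t _; rewrite -EFinD lee_fin /D gprod_cat (act_mulg isom).
  apply: le_trans (metric_triangle _ (act (gprod s) o) _) _.
  by rewrite mdist_act// addrC.
by rewrite ExD// ?Ex_cst// => *; exact: Ex_ge0.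
Qed.

(* Because [D >= u (1 - exp (lam u) exp (- lam D))] pointwise, as seen by comparing
   [D] and [u]. *)
Let a_ge n (u : R) : 0 <= u ->
  u - u * expR (lam * u) * (walk_const * expR (- (n%:R / (3 * n0%:R)))) <= a n.
Proof.
move=> u0; rewrite lerBlDr -lee_fin EFinD aE.
have c0 : 0 <= u * expR (lam * u) by rewrite mulr_ge0 ?expR_ge0.
apply: (@le_trans _ _ (Ex mu n (fun w => (D w)%:E + (u * expR (lam * u))%:E * (f o w)%:E)%E)).
  rewrite -[leLHS](Ex_cst mu0 n mu1) ?lee_fin//.
  apply: le_Ex => // w _; rewrite -EFinM -EFinD lee_fin /f mdistxx subr0 -mulrA -expRD -/(D w).
  have [uD|Du] := leP u (D w).
    by rewrite ler_wpDr// mulr_ge0 ?expR_ge0.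
  have : 1 <= expR (lam * u - lam * D w).
    by rewrite -[leLHS]expR0 ler_expR subr_ge0 ler_wpM2l ?(ltW lam0)// ltW.
  move=> /(ler_wpM2l u0); rewrite mulr1 => h; apply: le_trans h _.
  by rewrite lerDr mdist_ge0.
rewrite ExD; [|exact: mu0|by move=> w; rewrite lee_fin mdist_ge0
  |by move=> w; rewrite mule_ge0 ?f0 ?lee_fin].
rewrite ExZ; [|exact: mu0|exact: f0|by rewrite lee_fin].
apply: leeD => //; rewrite [leRHS]EFinM; apply: lee_wpmul2l; first by rewrite lee_fin.
exact: Ex_walk_le.
Qed.

Lemma rate_of_escape : exists2 l : R, 0 < l &
  ((n%:R^-1)%:E * Ex mu n (fun w => (D w)%:E))%E @[n --> \oo] --> l%:E.
Proof.
have [l al_l] := fekete a0 aD.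
have n0r : 0 < n0%:R :> R by rewrite ltr0n.
pose c := (12 * n0%:R * lam)^-1.
have c0 : 0 < c by rewrite invr_gt0 !mulr_gt0.
exists l.
  apply: lt_le_trans c0 _; rewrite -(cvg_lim _ al_l)//; apply: limr_ge.
    by apply/cvg_ex; exists l.
  near=> n.
  have n1 : (0 < n)%N by near: n; exact: nbhs_infty_gt.
  have n1' : 0 < n%:R :> R by rewrite ltr0n.
  have nbig : 12 * n0%:R * walk_const < n%:R by near: n; exact: nbhs_infty_gtr.
  (* Then [lam u] is half of the decay exponent [n / (3 n0)], so the error in [a_ge] is at most
     [u / 2] for large [n] and [a n / n >= 1 / (12 n0 lam)]. *)
  pose u := n%:R / (6 * n0%:R * lam).
  have u0 : 0 <= u by rewrite divr_ge0 ?mulr_ge0 ?(ltW lam0).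
  have := a_ge n u0.
  rewrite -[u * _ * _]mulrA (mulrCA (expR (lam * u))) -expRD.
  pose v := n%:R / (6 * n0%:R) : R.
  have -> : lam * u - n%:R / (3 * n0%:R) = - v.
    by rewrite /u /v; field; rewrite !gt_eqF.
  have v0 : 2 * walk_const <= v.
    by rewrite /v ler_pdivlMr ?mulr_gt0//; lra.
  have wev : walk_const * expR (- v) <= 2^-1.
    rewrite expRN ler_pdivrMr ?expR_gt0//.
    by have := expR_ge1Dx v; lra.
  have : u * (walk_const * expR (- v)) <= u * 2^-1 by rewrite ler_wpM2l.
  move=> h1 h2; have : u / 2 <= a n by lra.
  rewrite -(ler_pM2l (_ : 0 < n%:R^-1)) ?invr_gt0//; apply: le_trans.
  by rewrite /u /c le_eqVlt; apply/orP; left; apply/eqP; field; rewrite !gt_eqF.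
have -> : (fun n : nat => (n%:R^-1)%:E * Ex mu n (fun w => (D w)%:E))%E =
    (fun n : nat => (n%:R^-1 * a n)%:E).
  by apply/funext => n; rewrite EFinM aE.
by apply: cvg_EFin => //; near=> n.
Unshelve. all: by end_near. Qed.

End walk_bounds.

Lemma walkE (G : groupType) (Omega : Type) (xi : nat -> Omega -> G) n w :
  walk xi n w = gprod (mkseq (fun i => xi i w) n).
Proof.
by rewrite /walk /gprod big_map -(big_mkord xpredT (fun i => xi i w)) /index_iota subn0.
Qed.

Section walk_estimates.
Context {R : realType} {G : groupType} {X : metricType R}.
Variables (S : seq G) (act : G -> X -> X) (o : X).
Hypothesis gen : generates S.
Hypothesis isom : isometric_action act.

(** Left translation by [g0] is traded for a change of target point. *)
Let y g0 := act g0^-1%g o.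

Let orbit_distE g0 g : orbit_dist act o 1%g (g0 * g)%g = mdist (act g o) (y g0).
Proof.
rewrite /orbit_dist (act_one isom) (act_mulg isom) metric_sym.
by rewrite -[LHS](mdist_act isom g0^-1%g) (actK isom).
Qed.

Let orbit_dist1E g0 : orbit_dist act o 1%g g0 = mdist (y g0) o.
Proof. by rewrite -[g0 in LHS]mulg1 orbit_distE (act_one isom) metric_sym. Qed.

Variables (mu : G -> R) (d : measure_display) (Omega : measurableType d)
  (P : probability Omega R) (xi : nat -> Omega -> G).
Hypothesis mu0 : forall g, 0 <= mu g.
Hypothesis iidxi : iid P mu xi.

(** Chernoff bound: the indicator of the event is at most the exponential of [lam] times the
    deficit. *)
Lemma probability_walk_le (lam c : R) n g0 : 0 < lam ->
  (P [set w | (orbit_dist act o 1%g (g0 * walk xi n w)%g - orbit_dist act o 1%g g0 <= c)%R] <=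
   (expR (lam * c))%:E * Ex mu n (fun s =>
     (expR (- (lam * (mdist (act (gprod s) o) (y g0) - mdist (y g0) o))))%:E))%E.
Proof.
move=> lam0; set A := [set w | _].
have AE : A = [set w | [set s | mdist (act (gprod s) o) (y g0) - mdist (y g0) o <= c]
    (mkseq (fun i => xi i w) n)].
  by apply/seteqP; split=> w; rewrite /A /= orbit_distE orbit_dist1E walkE.
have mA : measurable A.
  by rewrite AE; exact: (measurable_words gen iidxi).
rewrite -[A]setIT -integral_indic//.
pose low s : R := (mdist (act (gprod s) o) (y g0) - mdist (y g0) o <= c)%R%:R.
have -> : (\int[P]_(w in setT) (\1_A w)%:E =
    \int[P]_w (low (mkseq (fun i => xi i w) n))%:E)%E.
  apply: eq_integral => w _; rewrite indicE AE /low; congr ((nat_of_bool _)%:R%:E).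
  by apply/idP/idP; rewrite inE.
rewrite (integral_words gen mu0 iidxi n (f := fun s => (low s)%:E)).
  rewrite -ExZ; [|exact: mu0|by move=> s; rewrite lee_fin expR_ge0|by rewrite lee_fin expR_ge0].
  apply: le_Ex => // s _; rewrite -EFinM lee_fin -expRD /low.
  case: (leP (mdist (act (gprod s) o) (y g0) - mdist (y g0) o) c) => [sc|_]; last exact: expR_ge0.
  by rewrite -[leLHS]expR0 ler_expR subr_ge0 ler_pM2l.
by move=> s; rewrite lee_fin.
Qed.

Lemma expectation_orbit_dist n :
  ('E_P[fun w => orbit_dist act o 1%g (walk xi n w)] =
   Ex mu n (fun s => (mdist (act (gprod s) o) o)%:E))%E.
Proof.
rewrite unlock -(integral_words gen mu0 iidxi n (f := fun s => (mdist (act (gprod s) o) o)%:E)).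
  apply: eq_integral => w _; rewrite walkE /orbit_dist (act_one isom).
  by rewrite metric_sym.
by move=> s; rewrite lee_fin mdist_ge0.
Qed.

End walk_estimates.

Theorem theorem9p1 (R : realType) (G : groupType) (S : seq G)
    (X : metricType R) (act : G -> X -> X) (x0 : X) (mu0 : G -> R)
    (generatesS : generates S)
    (geodesicX : geodesic X)
    (hyperbolicX : gromov_hyperbolic X)
    (isometric : isometric_action act)
    (acylindric : acylindrical act)
    (probability_mu0 : is_probability mu0)
    (tail_mu0 : exponential_tail S mu0)
    (nonelementary_mu0 :
       non_elementary act (generated_semigroup (msupport mu0))) :
  exists N : set (G -> R), [/\ is_neighborhood mu0 N,
    (exists2 C : R, 0 < C &
       forall mu : G -> R, N mu ->
       forall (d : measure_display) (Omega : measurableType d)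
         (P : probability Omega R) (xi : nat -> Omega -> G),
       iid P mu xi ->
       forall (n : nat) (g0 : G), (0 < n)%N ->
         (P [set w | (orbit_dist act x0 1%g (g0 * walk xi n w)%g
                       - orbit_dist act x0 1%g g0 <= n%:R / C)%R]
            <= (C * expR (- (n%:R / C)))%:E)%E) &
    (forall mu : G -> R, N mu ->
       forall (d : measure_display) (Omega : measurableType d)
         (P : probability Omega R) (xi : nat -> Omega -> G),
       iid P mu xi ->
       exists2 l : R, 0 < l &
         ((n%:R^-1)%:E *
            'E_P[fun w => orbit_dist act x0 1%g (walk xi n w)])%E
           @[n --> \oo] --> l%:E)].
Proof.
have [m00 m01] := is_probability_wsum probability_mu0.
have [al [L [al0 L0 mom0 [n0 n00 [lam /andP[lam0 lam_al] contr0]]]]] :=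
  contracting_time x0 generatesS geodesicX hyperbolicX isometric acylindric m00 m01
    tail_mu0 nonelementary_mu0.
have n0r : 0 < n0%:R :> R by rewrite ltr0n.
(* Gives [(1 + K)^n0 <= exp(1/4) <= 4/3], which degrades the contraction from [1/2] to [2/3]. *)
pose K : R := (4 * n0%:R)^-1.
have K0 : 0 < K by rewrite invr_gt0 mulr_gt0.
have K1 : K <= 1 by rewrite invf_le1 ?mulr_gt0// -natrM ler1n muln_gt0.
have Kn : (1 + K) ^+ n0 <= 4 / 3.
  have h : expR (n0%:R * K) <= 4 / 3.
    have -> : n0%:R * K = 4^-1 by rewrite /K; field; rewrite gt_eqF.
    have : 3 / 4 <= expR (- 4^-1) :> R by have := expR_ge1Dx (- 4^-1 : R); lra.
    rewrite expRN => h4; rewrite -[leLHS]invrK -[leRHS]invrK invf_div.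
    by rewrite lef_pV2 ?posrE ?invr_gt0 ?expR_gt0.
  apply: le_trans h; rewrite expRM_natl lerXn2r ?nnegrE ?expR_ge0//; last exact: expR_ge1Dx.
  by rewrite addr_ge0// ltW.
have near_mu0 mu : is_probability mu -> (ndist mu mu0 <= K%:E)%E ->
  [/\ forall g, 0 <= mu g, wsum mu (fun=> 1%E) = 1%E,
     (wsum mu (fun g => (expR (al * mdist (act g x0) x0))%:E) <= (expR (L + 1))%:E)%E &
     forall y : X, (Ex mu n0 (fun w => (expR (- (lam * (mdist (act (gprod w) x0) y
       - mdist y x0))))%:E) <= (2 / 3)%:E)%E].
  move=> pmu nmu; have [mu_ge0 mu1] := is_probability_wsum pmu.
  have mm := ndist_le pmu probability_mu0 nmu.
  have K10 : 0 <= 1 + K by rewrite addr_ge0// ltW.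
  split=> //.
    (* The moment is an expectation over words of length one, on which [head] never returns its
       default [1]. The factor [1 + K <= 2 <= exp 1] explains [L + 1]. *)
    have := @le_Ex_measure _ _ mu0 m00 mu (1 + K) 1
      (fun s => (expR (al * mdist (act (head 1%g s) x0) x0))%:E) mm mu_ge0 K10
      (fun s => _).
    rewrite /= expr1 => h; apply: le_trans (h _) _; first by move=> s; rewrite lee_fin expR_ge0.
    apply: le_trans (lee_wpmul2l _ mom0) _; first by rewrite lee_fin.
    rewrite -EFinM lee_fin expRD mulrC ler_wpM2l ?expR_ge0//.
    by have := expR_ge1Dx (1 : R); lra.
  move=> y; apply: le_trans (le_Ex_measure m00 n0 mm mu_ge0 K10 _) _.
    by move=> s; rewrite lee_fin expR_ge0.
  apply: le_trans (lee_wpmul2l _ (contr0 y)) _; first by rewrite lee_fin exprn_ge0.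
  by rewrite -EFinM lee_fin; lra.
have L10 : 0 <= L + 1 by rewrite addr_ge0.
exists [set mu | is_probability mu /\ (ndist mu mu0 <= K%:E)%E]; split.
- by exists K.
- pose W := walk_const (L + 1) n0.
  have W0 : 0 < W by exact: expR_gt0.
  (* The second summand ensures [lam n / C - n / (3 n0) <= - n / C], so the Chernoff factor is
     absorbed; the first dominates the multiplicative constant. *)
  pose C := W + 3 * n0%:R * (lam + 1).
  have D0 : 0 < 3 * n0%:R * (lam + 1) by rewrite !mulr_gt0// addr_gt0.
  have C0 : 0 < C by rewrite addr_gt0.
  exists C => // mu [pmu nmu] d Omega P xi iidxi n g0 n1.
  have [mu_ge0 mu1 mom contr] := near_mu0 mu pmu nmu.
  apply: le_trans (probability_walk_le x0 generatesS isometric mu_ge0 iidxi _ _ _ lam0) _.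
  have := Ex_walk_le isometric mu_ge0 L10 lam0 lam_al n00 mom contr n (act g0^-1%g x0).
  move=> /(lee_wpmul2l _) h; apply: le_trans (h _ _) _; first by rewrite lee_fin expR_ge0.
  rewrite -EFinM lee_fin mulrCA -expRD -/W.
  apply: ler_pM; rewrite ?(ltW W0) ?expR_ge0//; first by rewrite lerDl ltW.
  rewrite ler_expR.
  have : n%:R / C * (lam + 1) <= n%:R / (3 * n0%:R).
    rewrite -mulrA ler_wpM2l// ler_pdivrMl// ler_pdivlMr ?mulr_gt0//.
    by rewrite mulrC lerDr ltW.
  lra.
- move=> mu [pmu nmu] d Omega P xi iidxi.
  have [mu_ge0 mu1 mom contr] := near_mu0 mu pmu nmu.
  have [l l0 lP] := rate_of_escape isometric mu_ge0 mu1 L10 lam0 lam_al n00 mom contr.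
  exists l => //; apply: cvg_trans lP; apply: near_eq_cvg; near=> n.
  by rewrite (expectation_orbit_dist x0 generatesS isometric mu_ge0 iidxi).
Unshelve. all: by end_near. Qed.
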